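(* Let $\lambda$ be an uncountable cardinal such that $\square_\lambda+\mathsf{CH}_\lambda$ holds. Then: (1) $\diamondsuit\square'_\lambda(T)$ holds for every stationary $T\subseteq E^{\lambda^+}_{>\omega}\cap E^{\lambda^+}_{\neq\operatorname{cf}(\lambda)}$; (2) $\diamondsuit\square'_\lambda(S)$ holds for every $S\subseteq\lambda^+$ that reflects stationarily often.
   Context: $\operatorname{acc}(A)=\{\alpha\in A:\sup(A\cap\alpha)=\alpha\}$ for a set of ordinals $A$. $E^{\delta}_{\kappa}=\{\alpha<\delta:\operatorname{cf}(\alpha)=\kappa\}$, with $E^\delta_{>\kappa}$, $E^\delta_{\neq\kappa}$ analogous. $\mathsf{CH}_\lambda$ means $2^\lambda=\lambda^+$. $\square_\lambda$ asserts the existence of $\langle C_\alpha:\alpha<\lambda^+\rangle$ such that for every limit $\alpha<\lambda^+$, $C_\alpha$ is a club in $\alpha$ of order type $\le\lambda$, and $\beta\in\operatorname{acc}(C_\alpha)$ implies $C_\beta=C_\alpha\cap\beta$. For $S\subseteq\lambda^+$, $\diamondsuit\square'_\lambda(S)$ asserts the existence of a sequence $\langle (C_\alpha,S_\alpha):\alpha<\lambda^+\rangle$ with $S_\alpha\subseteq\alpha$ such that: (1) for every limit $\alpha<\lambda^+$, $C_\alpha$ is a club subset of $\alpha$ with $\operatorname{otp}(C_\alpha)\le\lambda$; (2) if $\beta\in\operatorname{acc}(C_\alpha)$ then $C_\beta=C_\alpha\cap\beta$ and $S_\beta=S_\alpha\cap\beta$; (3) for every club $D\subseteq\lambda^+$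 and every $A\subseteq\lambda^+$ there is $\alpha\in S$ with $C_\alpha\subseteq D$, $S_\alpha=A\cap\alpha$ and $\sup(\operatorname{acc}(C_\alpha))=\alpha$. A set $S\subseteq\lambda^+$ reflects stationarily often if $\{\alpha\in E^{\lambda^+}_{>\omega}:S\cap\alpha\text{ is stationary in }\alpha\}$ is stationary in $\lambda^+$. *)

(* Defs.v *)
(* The successor cardinal lambda^+ is modelled as a type W with
   a strict well-order [lt]; the cardinal lambda is an element [lam] of W.
   Subsets of ordinals are predicates W -> Prop. *)
Set Implicit Arguments.

Section Ordinals.
Variable W : Type.
Variable lt : W -> W -> Prop.

Definition le (x y : W) : Prop := lt x y \/ x = y.

Definition strict_wellorder : Prop :=
  (forall x, ~ lt x x) /\
  (forall x y z, lt x y -> lt y z -> lt x z) /\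
  (forall x y, lt x y \/ x = y \/ lt y x) /\
  well_founded lt.

Definition below (a : W) : W -> Prop := fun x => lt x a.

Definition injects (A B : W -> Prop) : Prop :=
  exists f : W -> W, (forall x, A x -> B (f x)) /\
    (forall x y, A x -> A y -> f x = f y -> x = y).

(* lam is a cardinal and W (as an ordered set) is lam^+ :
   lam is not equinumerous to a smaller ordinal, every proper initial segment
   of W has size <= lam, and W itself has size > lam. *)
Definition is_succ_card_of (lam : W) : Prop :=
  (forall g, lt g lam -> ~ injects (below lam) (below g)) /\
  (forall a, injects (below a) (below lam)) /\
  ~ injects (fun _ => True) (below lam).

Definition uncountable (lam : W) : Prop :=
  ~ exists f : W -> nat,
      forall x y, lt x lam -> lt y lam -> f x = f y -> x = y.

Definition is_limit (a : W) : Prop :=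
  (exists b, lt b a) /\ forall b, lt b a -> exists c, lt b c /\ lt c a.

Definition unbounded_in (A : W -> Prop) (a : W) : Prop :=
  forall b, lt b a -> exists c, A c /\ lt b c /\ lt c a.

Definition acc (A : W -> Prop) (b : W) : Prop :=
  A b /\ (exists g, lt g b) /\ unbounded_in A b.

Definition sup_is (X : W -> Prop) (a : W) : Prop :=
  (forall x, X x -> le x a) /\ (forall b, lt b a -> exists x, X x /\ lt b x).

Definition club_in (a : W) (C : W -> Prop) : Prop :=
  (forall x, C x -> lt x a) /\
  unbounded_in C a /\
  (forall b, lt b a -> is_limit b -> unbounded_in C b -> C b).

Definition club (C : W -> Prop) : Prop :=
  (forall b, exists c, C c /\ lt b c) /\
  (forall b, is_limit b -> unbounded_in C b -> C b).

Definition otp_le (C : W -> Prop) (lam : W) : Prop :=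
  exists f : W -> W, (forall x, C x -> lt (f x) lam) /\
    (forall x y, C x -> C y -> lt x y -> lt (f x) (f y)).

Definition cofinal_type (a k : W) : Prop :=
  exists f : W -> W,
    (forall x, lt x k -> lt (f x) a) /\
    (forall x y, lt x k -> lt y k -> lt x y -> lt (f x) (f y)) /\
    (forall b, lt b a -> exists x, lt x k /\ le b (f x)).

Definition is_cf (a k : W) : Prop :=
  cofinal_type a k /\ forall k', cofinal_type a k' -> le k k'.

Definition is_omega (w : W) : Prop :=
  is_limit w /\ forall b, lt b w -> ~ is_limit b.

Definition cf_gt_omega (a : W) : Prop :=
  exists k w, is_cf a k /\ is_omega w /\ lt w k.

Definition cf_neq (a b : W) : Prop :=
  exists k1 k2, is_cf a k1 /\ is_cf b k2 /\ k1 <> k2.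

Definition stationary (S : W -> Prop) : Prop :=
  forall D, club D -> exists a, S a /\ D a.

Definition stationary_in (a : W) (S : W -> Prop) : Prop :=
  forall D, club_in a D -> exists b, lt b a /\ S b /\ D b.

Definition reflects_stat_often (S : W -> Prop) : Prop :=
  stationary (fun a => cf_gt_omega a /\ stationary_in a S).

Definition square (lam : W) : Prop :=
  exists C : W -> W -> Prop,
    forall a, is_limit a ->
      club_in a (C a) /\ otp_le (C a) lam /\
      (forall b, acc (C a) b -> forall x, C b x <-> (C a x /\ lt x b)).

(* CH_lambda : 2^lambda <= lambda^+ (the reverse inequality is Cantor) *)
Definition CH (lam : W) : Prop :=
  exists F : (W -> Prop) -> W,
    forall A B, (forall x, A x -> lt x lam) -> (forall x, B x -> lt x lam) ->
      F A = F B -> forall x, A x <-> B x.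

Definition diamond_square (lam : W) (S : W -> Prop) : Prop :=
  exists C Sg : W -> W -> Prop,
    (forall a x, Sg a x -> lt x a) /\
    (forall a, is_limit a ->
       club_in a (C a) /\ otp_le (C a) lam /\
       (forall b, acc (C a) b ->
          (forall x, C b x <-> (C a x /\ lt x b)) /\
          (forall x, Sg b x <-> (Sg a x /\ lt x b)))) /\
    (forall D A : W -> Prop, club D ->
       exists a, S a /\ is_limit a /\ (forall x, C a x -> D x) /\
         (forall x, Sg a x <-> (A x /\ lt x a)) /\
         sup_is (acc (C a)) a).

End Ordinals.

(* Main.v *)
(* Fix a square sequence C. Call stage i a candidate sequence built from C and from the clubs and
   sets that defeated all stages i' < i; if every stage i < lam is defeated, look at a single
   suitable point a with |C_a| < lam. Each defeat destroys one element of a set attached to C_a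
   of size < lam, and there are lam stages: a contradiction, so some stage is not defeated.
   This is run twice.

   (i) Club guessing. The stage i candidate replaces each g in C_a by max(D_i cap (g+1)), D_i being
   the intersection of the clubs found so far. A defeat at i strictly lowers the image of some g,
   and each g can be lowered only finitely often.

   (ii) Guessing sets. By CH the approximations Z cap p of a candidate counterexample
   Z = (A_i : i < lam) are coded by ordinals. In a club guessed by C_a, the code of Z cap p lies
   below the successor g of p in C_a, so it has an index < lam in a fixed enumeration of g. If
   cf(a) <> cf(lam), the indices are below some j < lam for cofinally many g; keep only these g and
   let every code of index < j that is still consistent with the sets found so far propose the next
   set. A defeat at i discards a pair (g, code) among the |C_a| * j many pairs.

   In (2), if cf(a) = cf(lam) for stationarily many reflection points a, then club many b < a are
   limits of points of cofinality < cf(lam), and the arguments apply at such b in S. Otherwise (1)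
   applies to the reflection points, and coherence passes the guess down to some b in S. *)
Require Import Defs.
From Stdlib Require Import Classical ClassicalEpsilon IndefiniteDescription
  FunctionalExtensionality ProofIrrelevance Arith Lia List FinFun.

Set Implicit Arguments.

(** * Embeddings between types *)

Definition emb (A B : Type) : Prop := exists f : A -> B, forall x y, f x = f y -> x = y.

Lemma emb_refl (A : Type) : emb A A.
Proof. exists (fun x => x); auto. Qed.

Lemma emb_trans (A B C : Type) : emb A B -> emb B C -> emb A C.
Proof. intros [f Hf] [g Hg]. exists (fun x => g (f x)). auto. Qed.

Lemma emb_prod (A B C D : Type) : emb A C -> emb B D -> emb (A * B) (C * D).
Proof.
  intros [f Hf] [g Hg]. exists (fun p => (f (fst p), g (snd p))).
  intros [x y] [x' y'] E; injection E; intros E1 E2; f_equal; auto.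
Qed.

Lemma emb_option (A B : Type) : emb A B -> emb (option A) (option B).
Proof.
  intros [f Hf]. exists (option_map f).
  intros [x|] [y|] E; try discriminate; auto. injection E; intros; f_equal; auto.
Qed.

Lemma emb_sig (A : Type) (P Q : A -> Prop) :
  (forall x, P x -> Q x) -> emb {x | P x} {x | Q x}.
Proof.
  intros H. exists (fun x => exist Q (proj1_sig x) (H _ (proj2_sig x))).
  intros [x Hx] [y Hy] E; injection E; intros; now apply subset_eq_compat.
Qed.

(** Lets an embedding be specified by a relation, so that no function between sigma types has to be
    written out. *)
Lemma emb_choice (A B : Type) (R : A -> B -> Prop) :
  (forall a, exists b, R a b) -> (forall a a' b, R a b -> R a' b -> a = a') -> emb A B.
Proof.
  intros H1 H2.
  exists (fun a => proj1_sig (constructive_indefinite_description _ (H1 a))).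
  intros x y E.
  pose proof (proj2_sig (constructive_indefinite_description _ (H1 x))) as Hx.
  rewrite E in Hx.
  exact (H2 _ _ _ Hx (proj2_sig (constructive_indefinite_description _ (H1 y)))).
Qed.

Definition fin (n : nat) : Type := {k : nat | k < n}.

Lemma emb_fin_prod (n m : nat) : emb (fin n * fin m) (fin (n * m)).
Proof.
  assert (H : forall p : fin n * fin m,
    proj1_sig (fst p) * m + proj1_sig (snd p) < n * m).
  { intros [[a Ha] [b Hb]]; simpl. nia. }
  exists (fun p => exist (fun k => k < n * m) _ (H p)).
  intros [[a Ha] [b Hb]] [[c Hc] [d Hd]] E; injection E; simpl; intros E'.
  assert (a = c) by nia. subst c. assert (b = d) by nia. subst d.
  f_equal; now apply subset_eq_compat.
Qed.

Lemma emb_option_fin (n : nat) : emb (option (fin n)) (fin (S n)).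
Proof.
  apply emb_choice with (R := fun o k =>
    match o with None => proj1_sig k = n | Some j => proj1_sig k = proj1_sig j end).
  - intros [[k Hk]|].
    + assert (Hk' : k < S n) by lia. now exists (exist _ k Hk').
    + assert (Hk' : n < S n) by lia. now exists (exist _ n Hk').
  - intros [[a Ha]|] [[b Hb]|] [c Hc]; simpl; intros; subst; auto.
    + f_equal; now apply subset_eq_compat.
    + lia.
    + lia.
Qed.

(** Hilbert's hotel: shifting the copy of [nat] inside [A] by one frees [f 0] for [None]. *)
Lemma emb_option_inf (A : Type) : emb nat A -> emb (option A) A.
Proof.
  intros [f Hf].
  apply emb_choice with (R := fun o b =>
    match o with
    | None => b = f 0
    | Some a => (exists n, a = f n /\ b = f (S n)) \/ ((forall n, a <> f n) /\ b = a)
    end).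
  - intros [a|]; [|now exists (f 0)].
    destruct (classic (exists n, a = f n)) as [[n Hn]|Hn].
    + exists (f (S n)); eauto.
    + exists a. right. split; auto. intros n E; eauto.
  - assert (D : forall n m, f n = f m -> n = m) by auto.
    intros [a|] [b|] c H1 H2; auto.
    + f_equal. destruct H1 as [[n [H1 H1']]|[H1 H1']], H2 as [[m [H2 H2']]|[H2 H2']].
      * subst. apply D in H2'. injection H2'; intros; now subst.
      * subst. exfalso. eapply H2; eauto.
      * subst. exfalso. eapply H1; eauto.
      * congruence.
    + exfalso. destruct H1 as [[n [_ H1]]|[H1 H1']].
      * enough (0 = S n) by discriminate. apply D. congruence.
      * apply (H1 0). congruence.
    + exfalso. destruct H2 as [[n [_ H2]]|[H2 H2']].
      * enough (0 = S n) by discriminate. apply D. congruence.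
      * apply (H2 0). congruence.
Qed.

(** * Well-founded recursion *)

(** Packages [Fix] with its unfolding equation; extensionality supplies the congruence that [Fix_eq]
    asks of [G]. *)
Lemma wf_rec_ex (P : Type) (R : P -> P -> Prop) (T : Type)
  (G : forall i, (forall j, R j i -> T) -> T) :
  well_founded R -> exists D : P -> T, forall i, D i = G i (fun j _ => D j).
Proof.
  intros Hwf. exists (Fix Hwf (fun _ => T) G). intros i.
  apply (Fix_eq Hwf (fun _ => T) G).
  intros x f g E. f_equal.
  apply functional_extensionality_dep; intros y.
  apply functional_extensionality_dep; intros H. apply E.
Qed.

(* Greedy construction: send each p to a point of Q not used on the segment below p. *)
Lemma wo_emb (P Q : Type) (R : P -> P -> Prop) :
  well_founded R -> (forall x y, R x y \/ x = y \/ R y x) ->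
  (forall p, ~ emb Q {p' | R p' p}) -> emb P Q.
Proof.
  intros Hwf Htot Hseg.
  destruct (classic (inhabited P)) as [[p0]|HP].
  2:{ assert (e : P -> Q) by (intros p; exfalso; apply HP; now constructor).
      exists e. intros x; exfalso; apply HP; now constructor. }
  assert (HQ : inhabited Q).
  { apply NNPP; intros HQ. apply (Hseg p0).
    assert (e : Q -> {p' | R p' p0}) by (intros q; exfalso; apply HQ; now constructor).
    exists e. intros x; exfalso; apply HQ; now constructor. }
  destruct (@wf_rec_ex P R Q
    (fun p rec => epsilon HQ (fun q => forall p' (H : R p' p), rec p' H <> q)) Hwf)
    as [f Hf].
  assert (Hf' : forall p p', R p' p -> f p' <> f p).
  { intros p. rewrite (Hf p).
    apply (epsilon_spec HQ (fun q => forall p' (H : R p' p), f p' <> q)).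
    apply NNPP; intros Hn. apply (Hseg p).
    (* If every point of [Q] were already used below [p], choosing preimages would embed [Q] into
       that segment. *)
    apply emb_choice with (R := fun q s => f (proj1_sig s) = q).
    - intros q. apply NNPP; intros Hq. apply Hn. exists q. intros p' H E.
      apply Hq. now exists (exist _ p' H).
    - intros; congruence. }
  exists f. intros x y E.
  destruct (Htot x y) as [H|[H|H]]; auto; exfalso.
  - now apply (Hf' y x).
  - now apply (Hf' x y).
Qed.

Lemma infinite_emb_nat (Q : Type) : (forall n, ~ emb Q (fin n)) -> emb nat Q.
Proof.
  intros H. apply wo_emb with (R := Nat.lt).
  - apply lt_wf.
  - intros x y; unfold Nat.lt; lia.
  - exact H.
Qed.

Lemma not_emb_nat_fin (n : nat) : ~ emb nat (fin n).
Proof.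
  intros [f Hf].
  assert (H : NoDup (map (fun k => proj1_sig (f k)) (seq 0 (S n)))).
  { apply Injective_map_NoDup; [|apply seq_NoDup].
    intros x y E. apply Hf. destruct (f x), (f y); simpl in E. now apply subset_eq_compat. }
  apply NoDup_incl_length with (l' := seq 0 n) in H.
  - rewrite length_map, !length_seq in H. lia.
  - intros k Hk. apply in_map_iff in Hk. destruct Hk as [m [<- _]].
    apply in_seq. pose proof (proj2_sig (f m)). simpl in *. lia.
Qed.

(* Saturates the context with the consequences of a strict linear order. *)
Ltac order_with irr tr tot :=
  unfold le in *; intros;
  repeat match goal with
    | H : _ /\ _ |- _ => destruct H
    | H : _ \/ _ |- _ => destruct H
    end; subst; auto;
  repeat match goal with
    | H : ~ ?R ?x ?y, H0 : ?R _ _ |- _ =>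
        let K := fresh in destruct (tot x y) as [K|[K|K]]; [contradiction| | ]; clear H; subst
    | H : ~ ?R ?x ?y |- _ =>
        let K := fresh in destruct (tot x y) as [K|[K|K]]; [contradiction| | ]; clear H; subst
    end; auto;
  try match goal with
    | |- ?R ?x ?y => let K := fresh in destruct (tot x y) as [K|[K|K]]; [exact K| | ]; exfalso; subst
    | |- ?R ?x ?y \/ ?x = ?y =>
        let K := fresh in destruct (tot x y) as [K|[K|K]]; [now left|now right| ]; exfalso
    | |- ?x = ?y => let K := fresh in destruct (tot x y) as [K|[K|K]]; [ |exact K| ]; exfalso
    end;
  repeat match goal with
    | H : ?R ?x ?x |- _ => exfalso; exact (irr x H)
    | H : ?R ?x ?y, H' : ?R ?y ?z |- _ =>
        lazymatch goal with
        | _ : R x z |- _ => fail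
        | _ => pose proof (tr x y z H H')
        end
    end; try contradiction; eauto.

Notation seg lt a := {x | lt x a}.

(** * Strict well-orders and products of infinite cardinals *)

Section WellOrder.
Variables (W : Type) (lt : W -> W -> Prop).
Hypothesis Hwo : strict_wellorder lt.

Lemma ord_irr x : ~ lt x x. Proof. apply Hwo. Qed.
Lemma ord_tr x y z : lt x y -> lt y z -> lt x z. Proof. apply Hwo. Qed.
Lemma ord_tot x y : lt x y \/ x = y \/ lt y x. Proof. apply Hwo. Qed.
Lemma ord_wf : well_founded lt. Proof. apply Hwo. Qed.

Ltac order := solve [order_with ord_irr ord_tr ord_tot].

Lemma le_or_lt x y : le lt x y \/ lt y x. Proof. unfold le; destruct (ord_tot x y); intuition. Qed.

Lemma le_lt_tr x y z : le lt x y -> lt y z -> lt x z. Proof. order. Qed.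
Lemma lt_le_tr x y z : lt x y -> le lt y z -> lt x z. Proof. order. Qed.
Lemma le_tr x y z : le lt x y -> le lt y z -> le lt x z. Proof. order. Qed.
Lemma nlt_le x y : ~ lt x y -> le lt y x. Proof. order. Qed.
Lemma le_nlt x y : le lt x y -> ~ lt y x. Proof. intros H K. order. Qed.

Lemma least (P : W -> Prop) :
  (exists x, P x) -> exists x, P x /\ forall y, P y -> le lt x y.
Proof.
  intros [x Hx]. revert Hx. induction (ord_wf x) as [x _ IH]. intros Hx.
  destruct (classic (exists y, P y /\ lt y x)) as [[y [Py Hy]]|H]; [eauto|].
  exists x. split; auto. intros y Py. apply nlt_le. intros K; eauto.
Qed.

Lemma max2 x y : exists m, le lt x m /\ le lt y m /\ (m = x \/ m = y).
Proof. destruct (le_or_lt x y); [exists y|exists x]; unfold le in *; intuition. Qed.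

Lemma seg_wf a : well_founded (fun p q : seg lt a => lt (proj1_sig p) (proj1_sig q)).
Proof.
  assert (H : forall x p, proj1_sig p = x ->
    Acc (fun p q : seg lt a => lt (proj1_sig p) (proj1_sig q)) p).
  { intros x; induction (ord_wf x) as [x _ IH]. intros p <-. constructor. eauto. }
  intros p; eapply H; reflexivity.
Qed.

Lemma seg_tot a (p q : seg lt a) :
  lt (proj1_sig p) (proj1_sig q) \/ p = q \/ lt (proj1_sig q) (proj1_sig p).
Proof.
  destruct p as [x Hx], q as [y Hy]; simpl.
  destruct (ord_tot x y) as [H|[H|H]]; auto. right; left. now apply subset_eq_compat.
Qed.

Lemma emb_seg_le a b : le lt a b -> emb (seg lt a) (seg lt b).
Proof. intros H. apply emb_sig. intros x Hx. order. Qed.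

Lemma emb_le_option a : emb {x | le lt x a} (option (seg lt a)).
Proof.
  apply emb_choice with (R := fun x o =>
    match o with None => proj1_sig x = a | Some y => proj1_sig x = proj1_sig y end).
  - intros [x [Hx|Hx]]; [exists (Some (exist _ x Hx))|exists None]; auto.
  - intros [x Hx] [y Hy] [[z Hz]|]; simpl; intros; subst; now apply subset_eq_compat.
Qed.

Lemma emb_injects a b :
  emb (seg lt a) (seg lt b) <-> injects (below lt a) (below lt b).
Proof.
  unfold below. split.
  - intros [f Hf].
    exists (fun x => match excluded_middle_informative (lt x a) with
                     | left H => proj1_sig (f (exist _ x H)) | right _ => x end).
    split; intros x.
    + intros H; destruct (excluded_middle_informative _); [|tauto]. apply proj2_sig.
    + intros y Hx Hy. do 2 (destruct (excluded_middle_informative _); [|tauto]).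
      intros E.
      match type of E with proj1_sig ?u = proj1_sig ?v => assert (E' : u = v) end.
      { revert E. destruct (f _), (f _); simpl; intros; now apply subset_eq_compat. }
      apply Hf in E'. now injection E'.
  - intros [f [H1 H2]].
    exists (fun x => exist (fun y => lt y b) (f (proj1_sig x)) (H1 _ (proj2_sig x))).
    intros [x Hx] [y Hy] E; injection E; simpl; intros; apply subset_eq_compat; auto.
Qed.

(* Hessenberg's theorem, by Goedel's ordering of pairs: first by maximum, then lexicographically. *)
Lemma hessenberg a : emb nat (seg lt a) -> emb (seg lt a * seg lt a) (seg lt a).
Proof.
  induction (ord_wf a) as [a _ IH]. intros Hinf.
  (* If [a] is not an initial ordinal, the claim is inherited from a smaller [g]. Otherwise it
     suffices that no proper segment of the ordering of pairs has size at least that of [a]. *)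
  destruct (classic (exists g, lt g a /\ emb (seg lt a) (seg lt g))) as [[g [Hg Hag]]|Hcard].
  { eapply emb_trans; [apply emb_prod; exact Hag|].
    eapply emb_trans; [apply IH; eauto using emb_trans|].
    apply emb_seg_le; now left. }
  set (fst' := fun p : seg lt a * seg lt a => proj1_sig (fst p)).
  set (snd' := fun p : seg lt a * seg lt a => proj1_sig (snd p)).
  assert (Hmx : exists mx : seg lt a * seg lt a -> W,
    forall p, le lt (fst' p) (mx p) /\ le lt (snd' p) (mx p) /\ lt (mx p) a).
  { apply (functional_choice (fun p m => le lt (fst' p) m /\ le lt (snd' p) m /\ lt m a)). intros [[x Hx] [y Hy]].
    destruct (max2 x y) as [m [H1 [H2 [-> | ->]]]]; eauto. }
  destruct Hmx as [mx Hmx].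
  apply wo_emb with (R := fun p q => lt (mx p) (mx q) \/ mx p = mx q /\
    (lt (fst' p) (fst' q) \/ fst' p = fst' q /\ lt (snd' p) (snd' q))).
  - assert (H : forall m x y p, mx p = m -> fst' p = x -> snd' p = y ->
      Acc (fun p q => lt (mx p) (mx q) \/ mx p = mx q /\
      (lt (fst' p) (fst' q) \/ fst' p = fst' q /\ lt (snd' p) (snd' q))) p).
    { intros m; induction (ord_wf m) as [m _ IHm].
      intros x; induction (ord_wf x) as [x _ IHx].
      intros y; induction (ord_wf y) as [y _ IHy].
      intros p E1 E2 E3. constructor. intros q [H|[H [H'|[H' H'']]]]; subst; eauto. }
    intros p. eauto.
  - intros p q.
    destruct (ord_tot (mx p) (mx q)) as [H|[H|H]]; auto.
    destruct (ord_tot (fst' p) (fst' q)) as [H'|[H'|H']]; [tauto| |right; right; right; split; auto].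
    destruct (ord_tot (snd' p) (snd' q)) as [H''|[H''|H'']]; [tauto| |right; right; right; split; auto].
    right; left. destruct p as [[x Hx] [y Hy]], q as [[x' Hx'] [y' Hy']].
    unfold fst', snd' in *; simpl in H', H''. f_equal; now apply subset_eq_compat.
  - intros p. set (M := mx p). destruct (Hmx p) as [_ [_ HM]]. fold M in HM.
    intros Hemb.
    (* The segment below [p] lies in the square of [M + 1]. For infinite [M] the induction
       hypothesis then embeds [a] into [M], against initiality; for finite [M] it makes [a]
       finite. *)
    assert (H1 : emb (seg lt a) ({x | le lt x M} * {x | le lt x M})).
    { eapply emb_trans; [exact Hemb|].
      apply emb_choice with (R := fun q r => fst' (proj1_sig q) = proj1_sig (fst r) /\
                                   snd' (proj1_sig q) = proj1_sig (snd r)).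
      - intros [q Hq]. destruct (Hmx q) as [K1 [K2 _]].
        assert (K : le lt (mx q) M) by (unfold le; tauto).
        exists (exist _ (fst' q) (le_tr K1 K), exist _ (snd' q) (le_tr K2 K)). now split.
      - intros [[[x Hx] [y Hy]] Hq] [[[x' Hx'] [y' Hy']] Hq'] [[z Hz] [t Ht]].
        unfold fst', snd'; simpl. intros [-> ->] [-> ->].
        apply subset_eq_compat. f_equal; now apply subset_eq_compat. }
    pose proof (emb_trans H1 (emb_prod (emb_le_option M) (emb_le_option M))) as H2.
    destruct (classic (emb nat (seg lt M))) as [HMi|HMf].
    + apply Hcard. exists M. split; auto.
      eapply emb_trans; [exact H2|].
      eapply emb_trans; [apply emb_prod; apply emb_option_inf; exact HMi|]. auto.
    + assert (exists n, emb (seg lt M) (fin n)) as [n Hn].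
      { apply NNPP; intros H. apply HMf, infinite_emb_nat. eauto. }
      apply emb_option in Hn. pose proof (emb_trans Hn (emb_option_fin n)) as Hn'.
      apply (@not_emb_nat_fin (S n * S n)).
      eapply emb_trans; [exact Hinf|]. eapply emb_trans; [exact H2|].
      eapply emb_trans; [apply emb_prod; exact Hn'|]. apply emb_fin_prod.
Qed.

End WellOrder.

(** * Cofinality *)

Section Cofinality.
Variables (W : Type) (lt : W -> W -> Prop).
Hypothesis Hwo : strict_wellorder lt.

Let irr := ord_irr Hwo.
Let tr := ord_tr Hwo.
Let tot := ord_tot Hwo.
Ltac order := solve [order_with irr tr tot].

Lemma limit_of_unbounded (C : W -> Prop) (a b : W) :
  lt b a -> unbounded_in lt C a -> is_limit lt a.
Proof. intros H U. split; [eauto|]. intros c Hc. destruct (U c Hc) as [d [_ Hd]]. eauto. Qed.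

Lemma increasing_seq_lt (s : nat -> W) :
  (forall n, lt (s n) (s (S n))) -> forall n m, n < m -> lt (s n) (s m).
Proof. intros H n m L. induction L; eauto. Qed.

Lemma increasing_seq_sup (s : nat -> W) (a : W) :
  (forall n, lt (s n) (s (S n))) -> (forall n, lt (s n) a) ->
  exists m, le lt m a /\ is_limit lt m /\ (forall n, lt (s n) m) /\
    (forall x, lt x m -> exists n, lt x (s n)).
Proof.
  intros Hs Ha.
  destruct (@least _ _ Hwo (fun m => forall n, lt (s n) m)) as [m [H1 H2]]; [eauto|].
  assert (H3 : forall x, lt x m -> exists n, lt x (s n)).
  { intros x Hx. apply NNPP; intros N. apply (le_nlt Hwo (x := m) (y := x)); auto.
    apply H2. intros n. destruct (tot (s n) x) as [K|[K|K]]; auto; exfalso; apply N.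
    - exists (S n). subst; auto.
    - eauto. }
  exists m. split; [auto|]. split; [|auto].
  split; [exists (s 0); auto|].
  intros b Hb. destruct (H3 b Hb) as [n Hn]; eauto.
Qed.

Lemma iterate_below (P : W -> Prop) (R : W -> W -> Prop) (b : W) :
  P b -> (forall x, P x -> exists y, P y /\ R x y) ->
  exists s : nat -> W, s 0 = b /\ (forall n, P (s n)) /\ (forall n, R (s n) (s (S n))).
Proof.
  intros Hb H.
  destruct (functional_choice (fun (x y : {x | P x}) => R (proj1_sig x) (proj1_sig y)))
    as [F HF].
  { intros [x Hx]. destruct (H x Hx) as [y [Hy K]]. now exists (exist _ y Hy). }
  exists (fun n => proj1_sig (Nat.iter n F (exist _ b Hb))).
  repeat split; intros; [apply proj2_sig|]. apply HF.
Qed.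

(** Recursively, [f x] is a value of [u] above all earlier [f y] and at least [u x]. If the
    recursion first gets stuck at some [k'] below [k], the values before [k'] are already cofinal:
    otherwise a value of [u] above both a missed [b] and [u k'] would continue it. *)
Lemma cofinal_type_of_unbounded (a k : W) (u : W -> W) :
  (forall x, lt x k -> lt (u x) a) ->
  (forall b, lt b a -> exists x, lt x k /\ le lt b (u x)) ->
  exists k', le lt k' k /\ cofinal_type lt a k'.
Proof.
  intros H1 H2.
  set (good := fun x (f : forall y, lt y x -> W) z => (exists w, lt w k /\ z = u w) /\
    (forall y (H : lt y x), lt (f y H) z) /\ le lt (u x) z).
  destruct (@wf_rec_ex W lt W
    (fun x rec => epsilon (inhabits k) (good x rec)) (ord_wf Hwo)) as [f Hf].
  assert (Hg : forall x, (exists z, good x (fun y _ => f y) z) -> good x (fun y _ => f y) (f x)).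
  { intros x Hx. rewrite (Hf x). now apply epsilon_spec. }
  assert (Hk : forall k', (forall x, lt x k' -> exists z, good x (fun y _ => f y) z) ->
     (forall x, lt x k' -> lt (f x) a) /\
     (forall x y, lt x k' -> lt y k' -> lt x y -> lt (f x) (f y))).
  { intros k' Hk'. split.
    - intros x Hx. destruct (Hg x (Hk' x Hx)) as [[w [Hw ->]] _]. auto.
    - intros x y Hx Hy Hxy. now apply (Hg y (Hk' y Hy)). }
  destruct (classic (forall x, lt x k -> exists z, good x (fun y _ => f y) z)) as [All|No].
  - exists k. split; [now right|]. exists f. destruct (Hk k All) as [K1 K2].
    repeat split; auto.
    intros b Hb. destruct (H2 b Hb) as [x [Hx Hbx]]. exists x. split; auto.
    destruct (Hg x (All x Hx)) as [_ [_ L]]. eapply le_tr; eauto.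
  - destruct (@least _ _ Hwo (fun x => lt x k /\ ~ exists z, good x (fun y _ => f y) z))
      as [k' [[Hk'1 Hk'2] Hk'3]].
    { apply NNPP; intros N. apply No; intros x Hx. apply NNPP; intros M. eauto. }
    assert (Hb : forall x, lt x k' -> exists z, good x (fun y _ => f y) z).
    { intros x Hx. apply NNPP; intros N.
      apply (le_nlt Hwo (x := k') (y := x)); auto. apply Hk'3. split; auto. order. }
    destruct (Hk k' Hb) as [K1 K2].
    exists k'. split; [now left|]. exists f. repeat split; auto.
    intros b Hba. destruct (max2 Hwo b (u k')) as [m [M1 [M2 M3]]].
    assert (Hm : lt m a) by (destruct M3; subst; auto).
    destruct (H2 m Hm) as [w [Hw Hmw]].
    apply NNPP; intros N. apply Hk'2. exists (u w). repeat split.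
    + eauto.
    + intros y Hy. apply NNPP; intros M. apply N. exists y. split; auto.
      apply (nlt_le Hwo) in M. eapply le_tr; eauto. eapply le_tr; eauto.
    + eapply le_tr; eauto.
Qed.

Lemma is_cf_ex (a : W) : exists k, is_cf lt a k.
Proof.
  destruct (@least _ _ Hwo (cofinal_type lt a)) as [k [H1 H2]].
  - exists a, (fun x => x). repeat split; auto. intros b Hb. exists b. split; auto. now right.
  - now exists k.
Qed.

Lemma cf_le_of_unbounded (a k c : W) (u : W -> W) : is_cf lt a c ->
  (forall x, lt x k -> lt (u x) a) ->
  (forall b, lt b a -> exists x, lt x k /\ le lt b (u x)) -> le lt c k.
Proof.
  intros [_ Hc] H1 H2. destruct (cofinal_type_of_unbounded u H1 H2) as [k' [L K]].
  eapply le_tr; eauto.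
Qed.

Lemma limit_seq (w : W) : is_limit lt w ->
  exists s : nat -> W, (forall n, lt (s n) w) /\ (forall n, lt (s n) (s (S n))).
Proof.
  intros [[b Hb] H].
  destruct (iterate_below (fun x => lt x w) lt b Hb) as [s [_ Hs]]; [|eauto].
  intros x Hx. destruct (H x Hx) as [c [? ?]]; eauto.
Qed.

Lemma cf_gt_omega_seq (a : W) (s : nat -> W) : cf_gt_omega lt a ->
  (forall n, lt (s n) a) -> exists b, lt b a /\ forall n, lt (s n) b.
Proof.
  intros [k [w [Hk [[Hw _] Hwk]]]] Hs.
  apply NNPP; intros N.
  destruct (limit_seq Hw) as [t [Ht1 Ht2]].
  (* The sequence is reindexed by ordinals below [w] through the increasing [t]: [u (t n) = s n],
     with default [s 0] off the range of [t]. An unbounded [s] would then give cofinality at most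
     [w]. *)
  assert (Hu : exists u : W -> W, forall x, exists n, u x = s n /\ (forall m, x = t m -> m = n)).
  { apply (functional_choice (fun x y => exists n, y = s n /\ (forall m, x = t m -> m = n))).
    intros x. destruct (classic (exists m, x = t m)) as [[m ->]|M].
    - exists (s m), m. split; auto. intros m' E.
      destruct (Nat.lt_trichotomy m m') as [L|[L|L]]; auto;
        apply (increasing_seq_lt _ Ht2) in L; rewrite E in L; exfalso; eapply irr; eauto.
    - exists (s 0), 0. split; auto. intros m E; exfalso; eauto. }
  destruct Hu as [u Hu].
  apply (le_nlt Hwo (x := k) (y := w)); auto.
  apply (@cf_le_of_unbounded a w k u); auto.
  - intros x _. destruct (Hu x) as [n [-> _]]; auto.
  - intros b Hb. apply NNPP; intros M. apply N. exists b. split; auto.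
    intros n. apply NNPP; intros L. apply M. exists (t n). split; auto.
    destruct (Hu (t n)) as [m [E1 E2]]. rewrite E1, <- (E2 n eq_refl). order.
Qed.

(** Zero has cofinality zero, and for a successor the constant sequence at its predecessor would be
    unbounded. *)
Lemma cf_gt_omega_limit (a : W) : cf_gt_omega lt a -> is_limit lt a.
Proof.
  intros H. split.
  - apply NNPP; intros N. destruct H as [k [w [[_ Hk] [_ Hwk]]]].
    destruct (@least _ _ Hwo (fun _ => True)) as [z [_ Hz]]; [eauto|].
    assert (Hkz : le lt k z).
    { apply Hk. exists (fun x => x). repeat split; auto.
      - intros x Hx. exfalso. specialize (Hz x I). order.
      - intros b Hb. exfalso; eauto. }
    specialize (Hz w I). order.
  - intros b Hb. destruct (@cf_gt_omega_seq a (fun _ => b) H) as [c [Hc Hbc]]; auto.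
    exists c. split; auto. exact (Hbc 0).
Qed.

(** Alternate between points of [X] and of [Y] for omega steps; uncountable cofinality keeps the
    supremum below [a]. Taking [X = Y] handles a single set. *)
Lemma common_limits_club (a : W) (X Y : W -> Prop) : cf_gt_omega lt a ->
  unbounded_in lt X a -> unbounded_in lt Y a ->
  club_in lt a (fun b => lt b a /\ is_limit lt b /\ unbounded_in lt X b /\ unbounded_in lt Y b).
Proof.
  intros Ha HX HY. split; [tauto|split].
  - intros b Hb.
    destruct (iterate_below (fun x => lt x a)
      (fun x y => lt x y /\ (exists p, X p /\ lt x p /\ lt p y) /\
                            (exists p, Y p /\ lt x p /\ lt p y)) b Hb) as [s [H0 [Hs1 Hs2]]].
    { intros x Hx. destruct (HX x Hx) as [p [Hp [Hxp Hpa]]].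
      destruct (HY p Hpa) as [q [Hq [Hpq Hqa]]].
      destruct (cf_gt_omega_limit Ha) as [_ L]. destruct (L q Hqa) as [y [Hy1 Hy2]].
      exists y. repeat split; eauto 7. }
    destruct (cf_gt_omega_seq s Ha Hs1) as [c [Hc1 Hc2]].
    destruct (@increasing_seq_sup s c) as [m [M1 [M2 [M3 M4]]]]; auto.
    { intros n; apply Hs2. }
    exists m. split; [split; [order|split; [auto|split]]|split].
    + intros x Hx. destruct (M4 x Hx) as [n Hn].
      destruct (Hs2 n) as [_ [[p [P1 [P2 P3]]] _]]. exists p. repeat split; eauto.
    + intros x Hx. destruct (M4 x Hx) as [n Hn].
      destruct (Hs2 n) as [_ [_ [p [P1 [P2 P3]]]]]. exists p. repeat split; eauto.
    + subst b. auto.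
    + order.
  - intros b Hb Hbl H1. split; [auto|split; [auto|split]].
    { intros x Hx. destruct (H1 x Hx) as [c [[_ [_ [U _]]] [K1 K2]]].
      destruct (U x K1) as [d [? [? ?]]]. exists d; repeat split; eauto. }
    intros x Hx. destruct (H1 x Hx) as [c [[_ [_ [_ U]]] [K1 K2]]].
    destruct (U x K1) as [d [? [? ?]]]. exists d; repeat split; eauto.
Qed.

End Cofinality.

(** * Small sets and clubs in a successor cardinal *)

Section SuccCard.
Variables (W : Type) (lt : W -> W -> Prop) (lam : W).
Hypothesis Hwo : strict_wellorder lt.
Hypothesis Hsucc : is_succ_card_of lt lam.
Hypothesis Hunc : uncountable lt lam.

Let irr := ord_irr Hwo.
Let tr := ord_tr Hwo.
Let tot := ord_tot Hwo.
Ltac order := solve [order_with irr tr tot].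

Definition small (A : Type) : Prop := exists g, lt g lam /\ emb A (seg lt g).

Lemma not_emb_lam_nat : ~ emb (seg lt lam) nat.
Proof.
  intros [f Hf]. apply Hunc.
  exists (fun x => match excluded_middle_informative (lt x lam) with
                   | left H => f (exist _ x H) | right _ => 0 end).
  intros x y Hx Hy. do 2 (destruct (excluded_middle_informative _); [|tauto]).
  intros E. apply Hf in E. now injection E.
Qed.

(** If [nat] fitted into no ordinal below [lam], the greedy construction would embed [lam] into
    [nat]. *)
Lemma small_nat : small nat.
Proof.
  apply NNPP; intros N. apply not_emb_lam_nat.
  apply wo_emb with (R := fun p q : seg lt lam => lt (proj1_sig p) (proj1_sig q)).
  - apply seg_wf; auto.
  - apply seg_tot; auto.
  - intros [p Hp] H. simpl in H. apply N. exists p. split; auto.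
    eapply emb_trans; [exact H|].
    exists (fun x : {p' : seg lt lam | lt (proj1_sig p') p} =>
      exist (fun y => lt y p) (proj1_sig (proj1_sig x)) (proj2_sig x)).
    intros [[x Hx] Hx'] [[y Hy] Hy'] E. injection E; simpl; intros.
    apply subset_eq_compat. now apply subset_eq_compat.
Qed.

Lemma emb_nat_lam : emb nat (seg lt lam).
Proof.
  destruct small_nat as [g [Hg H]]. eapply emb_trans; [exact H|].
  apply emb_seg_le; [auto|now left].
Qed.

(** The counting contradiction that ends both iterations. Both factors fit into one [M] below [lam],
    made infinite by [g3], and [M] absorbs its square. *)
Lemma not_emb_lam_small_prod (A B : Type) : small A -> small B -> ~ emb (seg lt lam) (A * B).
Proof.
  intros [g1 [G1 E1]] [g2 [G2 E2]] E.
  destruct small_nat as [g3 [G3 E3]].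
  destruct (max2 Hwo g1 g2) as [m [M1 [M2 M3]]].
  destruct (max2 Hwo m g3) as [M [M4 [M5 M6]]].
  assert (HM : lt M lam) by (destruct M6, M3; subst; auto).
  destruct Hsucc as [H _]. apply (H M HM). apply emb_injects.
  eapply emb_trans; [exact E|].
  eapply emb_trans; [apply emb_prod; [exact E1|exact E2]|].
  eapply emb_trans; [apply emb_prod; apply (@emb_seg_le _ _ Hwo _ M); order|].
  apply hessenberg; auto.
  eapply emb_trans; [exact E3|]. now apply emb_seg_le.
Qed.

Lemma index_ex : exists q : W -> W -> W,
  (forall a x, lt x a -> lt (q a x) lam) /\
  (forall a x y, lt x a -> lt y a -> q a x = q a y -> x = y).
Proof.
  destruct (functional_choice (fun a (f : W -> W) => (forall x, lt x a -> lt (f x) lam) /\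
     (forall x y, lt x a -> lt y a -> f x = f y -> x = y))) as [q Hq].
  - apply Hsucc.
  - exists q. split; intros a; apply Hq.
Qed.

Lemma emb_seg_lam (a : W) : emb (seg lt a) (seg lt lam).
Proof. apply emb_injects; apply Hsucc. Qed.

Lemma emb_lam_lam : emb (seg lt lam * seg lt lam) (seg lt lam).
Proof. apply hessenberg; auto. apply emb_nat_lam. Qed.

Lemma emb_le_lam (a : W) : emb {x | le lt x a} (seg lt lam).
Proof.
  eapply emb_trans; [apply emb_le_option|].
  eapply emb_trans; [apply emb_option, emb_seg_lam|].
  apply emb_option_inf, emb_nat_lam.
Qed.

(* lam^+ is regular. *)
Lemma bounded_family (I : Type) (f : I -> W) :
  emb I (seg lt lam) -> exists b, forall i, lt (f i) b.
Proof.
  intros [e He]. apply NNPP; intros N.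
  set (q := fun a => proj1_sig (constructive_indefinite_description _ (emb_le_lam a))).
  assert (Hq : forall a x y, q a x = q a y -> x = y).
  { intros a. exact (proj2_sig (constructive_indefinite_description _ (emb_le_lam a))). }
  assert (H : emb W (seg lt lam * seg lt lam)).
  (* If the family were unbounded, each [b] would lie below some [f i] and be coded by [i] together
     with its index below [f i]. *)
  { apply emb_choice with (R := fun b z => exists i (H : le lt b (f i)),
      fst z = e i /\ snd z = q (f i) (exist _ b H)).
    - intros b. apply NNPP; intros M. apply N. exists b. intros i.
      apply NNPP; intros L. apply (nlt_le Hwo) in L. apply M.
      exists (e i, q (f i) (exist _ b L)), i, L. now split.
    - intros b b' [z1 z2] [i [H [E1 E2]]] [i' [H' [E1' E2']]]; simpl in *.
      assert (i = i') by (apply He; congruence). subst i'.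
      assert (E : exist (fun x => le lt x (f i)) b H = exist _ b' H') by (apply (Hq (f i)); congruence).
      now injection E. }
  destruct (emb_trans H emb_lam_lam) as [g Hg].
  destruct Hsucc as [_ [_ K]]. apply K.
  exists (fun x => proj1_sig (g x)). split.
  - intros x _. apply proj2_sig.
  - intros x y _ _ E. apply Hg. destruct (g x), (g y). simpl in E. now apply subset_eq_compat.
Qed.

Lemma upper_ex (x : W) : exists y, lt x y.
Proof.
  destruct (@bounded_family {y | le lt y x} (fun y => proj1_sig y) (emb_le_lam x)) as [b Hb].
  exists b. exact (Hb (exist _ x (or_intror eq_refl))).
Qed.

Lemma upper2_ex (x y : W) : exists z, lt x z /\ lt y z.
Proof. destruct (max2 Hwo x y) as [m [? [? _]]], (upper_ex m) as [z ?]. exists z; split; order. Qed.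

(** Each step passes to a bound for [F] on the whole segment reached so far; the supremum of omega
    steps is closed under [F]. The other club constructions reduce to this one. *)
Lemma closure_club (F : W -> W) :
  club lt (fun d => is_limit lt d /\ forall x, lt x d -> lt (F x) d).
Proof.
  split.
  - intros b.
    destruct (iterate_below (fun _ => True)
      (fun x y => lt x y /\ forall z, le lt z x -> lt (F z) y) b I) as [s [H0 [_ Hs]]].
    { intros x _.
      destruct (@bounded_family {y | le lt y x} (fun y => F (proj1_sig y)) (emb_le_lam x))
        as [c Hc].
      destruct (upper2_ex x c) as [y [Hxy Hcy]]. exists y. repeat split; auto.
      intros z Hz. specialize (Hc (exist _ z Hz)); simpl in Hc. eauto. }
    destruct (@bounded_family nat s emb_nat_lam) as [a Ha].
    destruct (@increasing_seq_sup _ _ Hwo s a) as [m [M1 [M2 [M3 M4]]]]; auto.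
    { intros n; apply Hs. }
    exists m. split; [split; auto|subst b; auto].
    intros x Hx. destruct (M4 x Hx) as [n Hn].
    apply tr with (s (S n)); auto. apply Hs. now left.
  - intros b Hb U. split; auto. intros x Hx.
    destruct (U x Hx) as [c [[_ K] [L1 L2]]]. eauto.
Qed.

Lemma club_limits (E : W -> Prop) : club lt E ->
  club lt (fun d => is_limit lt d /\ unbounded_in lt E d).
Proof.
  intros [H1 H2]. destruct (functional_choice _ H1) as [F HF].
  destruct (closure_club F) as [K1 K2]. split.
  - intros b. destruct (K1 b) as [c [[L1 L2] L3]]. exists c. repeat split; auto; try apply L1.
    intros x Hx. exists (F x). repeat split; try apply HF. auto.
  - intros b Hb U. split; auto. intros x Hx.
    destruct (U x Hx) as [c [[_ K] [L1 L2]]]. destruct (K x L1) as [d [? [? ?]]].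
    exists d; repeat split; eauto.
Qed.

Lemma club_of_limit (E : W -> Prop) (b : W) :
  club lt E -> is_limit lt b -> unbounded_in lt E b -> E b.
Proof. intros [_ H]. auto. Qed.

(** By regularity some [F] has a point of every [D i] between [x] and [F x]; closure points of [F]
    are then limits of all the [D i]. *)
Lemma club_inter (I : Type) (D : I -> W -> Prop) : emb I (seg lt lam) ->
  (forall i, club lt (D i)) -> club lt (fun x => forall i, D i x).
Proof.
  intros HI HD.
  assert (H : forall x, exists y, forall i, exists z, D i z /\ lt x z /\ lt z y).
  { intros x.
    destruct (functional_choice (fun i z => D i z /\ lt x z)) as [f Hf].
    { intros i. apply HD. }
    destruct (@bounded_family I f HI) as [b Hb]. exists b. intros i.
    exists (f i). specialize (Hf i). specialize (Hb i). tauto. }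
  destruct (functional_choice _ H) as [F HF].
  destruct (closure_club F) as [K1 K2]. split.
  - intros b. destruct (K1 b) as [c [[L1 L2] L3]]. exists c. split; auto.
    intros i. apply club_of_limit; auto.
    intros x Hx. destruct (HF x i) as [z [Z1 [Z2 Z3]]]. exists z. repeat split; auto.
    specialize (L2 x Hx). eauto.
  - intros b Hb U i. apply club_of_limit; auto.
    intros x Hx. destruct (U x Hx) as [c [K [L L']]]. exists c; auto.
Qed.

Lemma club_inter2 (D E : W -> Prop) :
  club lt D -> club lt E -> club lt (fun x => D x /\ E x).
Proof.
  intros HD HE.
  destruct (@club_inter bool (fun b => if b then D else E)) as [K1 K2].
  - eapply emb_trans; [|exact emb_nat_lam]. exists (fun b : bool => if b then 0 else 1).
    intros [|] [|]; auto; discriminate.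
  - intros [|]; auto.
  - split.
    + intros b. destruct (K1 b) as [c [L1 L2]]. exists c. split; auto.
      split; [exact (L1 true)|exact (L1 false)].
    + intros b Hb U. split; apply club_of_limit; auto; intros x Hx;
        destruct (U x Hx) as [c [[? ?] [L L']]]; exists c; auto.
Qed.

End SuccCard.

(* A strictly decreasing family of ordinals is finite, hence so are the fibres of [a];
   [r t] counts the record points of the fibre below [t]. *)
Lemma emb_descending_fibres (W : Type) (lt : W -> W -> Prop) (P A : Type) (R : P -> P -> Prop)
  (a : P -> A) (y : P -> W) : strict_wellorder lt ->
  well_founded R -> (forall s t, R s t \/ s = t \/ R t s) ->
  (forall s t, R s t -> a s = a t -> lt (y t) (y s)) -> emb P (A * nat).
Proof.
  intros Hwo Hwf Htot Hy.
  (* Values decrease along a fibre, so the earlier member with least value is the last one before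
     [t]. A first member gets an arbitrary number from [epsilon]; only strict growth of [r] along
     the fibre matters. *)
  set (prev := fun t s => R s t /\ a s = a t /\
         forall s', R s' t -> a s' = a t -> le lt (y s) (y s')).
  destruct (@wf_rec_ex P R nat (fun t rec => epsilon (inhabits 0)
    (fun n => exists s (H : R s t), prev t s /\ n = S (rec s H))) Hwf) as [r Hr].
  assert (Hmono : forall t s, R s t -> a s = a t -> r s < r t).
  { intros t. induction (Hwf t) as [t _ IH]. intros s Hst Est.
    assert (Hp : exists n, exists s (H : R s t), prev t s /\ n = S (r s)).
    { destruct (@least _ _ Hwo (fun z => exists s, R s t /\ a s = a t /\ z = y s))
        as [z [[s0 [S1 [S2 ->]]] S3]]; [exists (y s), s; auto|].
      exists (S (r s0)), s0, S1. repeat split; auto.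
      intros s' H1 H2. apply S3. eauto. }
    destruct (epsilon_spec (inhabits 0) _ Hp) as [p [Hpt [[_ [Hpa Hpm]] E]]].
    rewrite <- Hr in E. rewrite E.
    destruct (Htot s p) as [H|[H|H]].
    - assert (r s < r p) by (apply IH; congruence). lia.
    - subst; lia.
    - exfalso. apply (le_nlt Hwo (Hpm s Hst Est)). apply Hy; congruence. }
  exists (fun t => (a t, r t)). intros s t E. injection E; intros E1 E2.
  destruct (Htot s t) as [H|[H|H]]; auto; apply Hmono in H; auto; lia.
Qed.

(** * Square sequences and the club guessing principles *)

Section Squares.
Variables (W : Type) (lt : W -> W -> Prop) (lam : W).
Hypothesis Hwo : strict_wellorder lt.
Hypothesis Hsucc : is_succ_card_of lt lam.
Hypothesis Hunc : uncountable lt lam.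

Let irr := ord_irr Hwo.
Let tr := ord_tr Hwo.
Let tot := ord_tot Hwo.
Ltac order := solve [order_with irr tr tot].

Definition adjacent (c : W -> Prop) (p g : W) : Prop :=
  c p /\ c g /\ lt p g /\ forall x, c x -> lt p x -> le lt g x.

Definition square_seq (C : W -> W -> Prop) : Prop :=
  forall a, is_limit lt a -> club_in lt a (C a) /\ otp_le lt (C a) lam /\
    (forall b, acc lt (C a) b -> forall x, C b x <-> (C a x /\ lt x b)).

(** This form yields [sup_is (acc (C a)) a] once [B] is kept inside the club, since the club
    contains its limits. *)
Definition limits_cofinal (B : W -> Prop) (a : W) : Prop :=
  unbounded_in lt (fun b => is_limit lt b /\ unbounded_in lt B b) a.

(* [B] will be the set of successor points of [C' a] for a modified sequence [C'], of which only
   the limit points are known in advance. *)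
Definition guess_ready (C : W -> W -> Prop) (S : W -> Prop) : Prop :=
  forall E, club lt E -> exists a, S a /\ is_limit lt a /\ unbounded_in lt E a /\
    small lt lam {x | C a x} /\
    forall (B : W -> Prop) (h : W -> W), (forall b, B b -> lt b a) -> unbounded_in lt B a ->
      (forall b, lt b a -> is_limit lt b -> unbounded_in lt (C a) b ->
         unbounded_in lt E b -> unbounded_in lt B b) ->
      (forall b, B b -> lt (h b) lam) ->
      exists j, lt j lam /\ limits_cofinal (fun b => B b /\ lt (h b) j) a.

(** Club guessing with a bound on indices built in: [h p g] will be the index, in the enumeration of
    [g], of the code of an approximation up to [p]. *)
Definition guesses_clubs (C : W -> W -> Prop) (S : W -> Prop) : Prop :=
  forall (D : W -> Prop) (h : W -> W -> W), club lt D ->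
    (forall p g, D p -> D g -> lt p g -> lt (h p g) lam) ->
    exists a, S a /\ is_limit lt a /\ (forall x, C a x -> D x) /\ small lt lam {x | C a x} /\
      exists j, lt j lam /\
        limits_cofinal (fun g => exists p, adjacent (C a) p g /\ lt (h p g) j) a.

Lemma unbounded_mono (A B : W -> Prop) (a : W) :
  (forall x, A x -> lt x a -> B x) -> unbounded_in lt A a -> unbounded_in lt B a.
Proof. intros H U b Hb. destruct (U b Hb) as [c [? [? ?]]]. exists c; auto. Qed.

Lemma unbounded_trans (A : W -> Prop) (a : W) :
  unbounded_in lt (fun b => unbounded_in lt A b) a -> unbounded_in lt A a.
Proof.
  intros U b Hb. destruct (U b Hb) as [c [K [? ?]]]. destruct (K b) as [d [? [? ?]]]; auto.
  exists d; eauto.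
Qed.

Lemma limits_cofinal_mono (A B : W -> Prop) (a : W) :
  (forall x, A x -> B x) -> limits_cofinal A a -> limits_cofinal B a.
Proof.
  intros H. apply unbounded_mono. intros x [K1 K2] _. split; auto.
  eapply unbounded_mono; [|exact K2]. auto.
Qed.

Lemma adjacent_unique (c : W -> Prop) p p' g : adjacent c p g -> adjacent c p' g -> p = p'.
Proof.
  intros [P1 [_ [P2 P3]]] [P1' [_ [P2' P3']]].
  destruct (tot p p') as [H|[H|H]]; auto; exfalso.
  - specialize (P3 _ P1' H). order.
  - specialize (P3' _ P1 H). order.
Qed.

Lemma adjacent_ex (c : W -> Prop) (p x : W) : c p -> c x -> lt p x ->
  exists g, adjacent c p g /\ le lt g x.
Proof.
  intros Hp Hx L. destruct (@least _ _ Hwo (fun g => c g /\ lt p g)) as [g [[G1 G2] G3]]; [eauto|].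
  exists g. repeat split; auto.
Qed.

Lemma adjacent_unbounded (c : W -> Prop) (a : W) :
  unbounded_in lt c a -> unbounded_in lt (fun g => exists p, adjacent c p g) a.
Proof.
  intros U b Hb. destruct (U b Hb) as [p [P1 [P2 P3]]]. destruct (U p P3) as [x [X1 [X2 X3]]].
  destruct (adjacent_ex c P1 X1 X2) as [g [G1 G2]]. exists g. split; [eauto|].
  destruct G1 as [_ [_ [L _]]]. split; order.
Qed.

Lemma adjacent_restrict (c c' : W -> Prop) (d p g : W) : (forall x, c' x <-> c x /\ lt x d) ->
  (adjacent c' p g <-> adjacent c p g /\ lt g d).
Proof.
  intros H. unfold adjacent. rewrite !H. split.
  - intros [[P1 P2] [[G1 G2] [L M]]]. repeat split; auto.
    intros x Hx Lx. destruct (tot x d) as [K|K]; [apply M; auto; now apply H|order].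
  - intros [[P1 [G1 [L M]]] Hg]. repeat split; eauto. intros x Hx. apply M. now apply H.
Qed.

(** * Dropping a square sequence into a club *)

Definition floor_in (D : W -> Prop) (x g : W) : Prop :=
  D x /\ le lt x g /\ forall d, D d -> lt x d -> lt g d.

(** The least upper bound of the points of [D] up to [g] is itself in [D], since otherwise it would
    be a limit of [D]. *)
Lemma floor_ex (D : W -> Prop) (d g : W) : club lt D -> D d -> le lt d g ->
  exists x, floor_in D x g /\ le lt d x.
Proof.
  intros HD Hd Hdg.
  destruct (@least _ _ Hwo (fun u => forall d, D d -> le lt d g -> le lt d u)) as [u [U1 U2]].
  { exists g; auto. }
  assert (Hug : le lt u g) by (apply U2; auto).
  assert (Hdu : le lt d u) by auto.
  assert (HDu : D u).
  { destruct Hdu as [Hdu| ->]; auto. apply NNPP; intros N.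
    assert (U : unbounded_in lt D u).
    { intros b Hb. apply NNPP; intros M. apply (le_nlt Hwo (x := u) (y := b)); auto.
      apply U2. intros e He Heg. destruct (U1 e He Heg) as [K| ->]; [|tauto].
      apply (nlt_le Hwo). intros L. apply M. eauto. }
    apply N, (club_of_limit HD); auto. eapply limit_of_unbounded; eauto. }
  exists u. repeat split; auto. intros e He Hue.
  destruct (tot g e) as [K|K]; auto. exfalso.
  assert (le lt e u) by (apply U1; auto; order). order.
Qed.

Lemma floor_unique D x x' g : floor_in D x g -> floor_in D x' g -> x = x'.
Proof.
  intros [H1 [H2 H3]] [H1' [H2' H3']].
  destruct (tot x x') as [K|[K|K]]; auto; exfalso; [specialize (H3 _ H1' K)|specialize (H3' _ H1 K)];
    order.
Qed.

(** When [D] is bounded below [a], the tail of [C a] beyond [D] is taken. Its accumulation points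
    are not limits of [D], whereas in the first case all of them are, so the same case applies at
    [a] and at its accumulation points, as coherence requires. *)
Definition drop (C : W -> W -> Prop) (D : W -> Prop) (a x : W) : Prop :=
  (unbounded_in lt D a /\ exists g, C a g /\ floor_in D x g) \/
  (~ unbounded_in lt D a /\ C a x /\ forall d, D d -> le lt x d -> le lt a d).

Lemma drop_unbounded C D a b : club lt D -> unbounded_in lt D a ->
  unbounded_in lt D b -> unbounded_in lt (C a) b -> unbounded_in lt (drop C D a) b.
Proof.
  intros HD UDa UD UC x Hx.
  destruct (UD x Hx) as [d [D1 [D2 D3]]]. destruct (UC d D3) as [g [G1 [G2 G3]]].
  destruct (@floor_ex D d g HD D1) as [y [Y1 Y2]]; [now left|].
  exists y. split; [left; eauto|]. destruct Y1 as [_ [Y1 _]]. split; order.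
Qed.

(** A preimage [g] of a floor below [b] is itself below [b], because [D] has a point between that
    floor and [b], and this point exceeds [g]. *)
Lemma drop_limit C D a b : (forall x, C a x -> lt x a) ->
  unbounded_in lt D a -> unbounded_in lt (drop C D a) b ->
  unbounded_in lt D b /\ unbounded_in lt (C a) b.
Proof.
  intros HC UDa U.
  assert (UD : unbounded_in lt D b).
  { eapply unbounded_mono; [|exact U]. intros x [[_ [g [_ [K _]]]]|[N _]] _; tauto. }
  split; auto.
  intros x Hx. destruct (U x Hx) as [y [[[_ [g [G1 [G2 [G3 G4]]]]]|[N _]] [Y1 Y2]]]; [|tauto].
  exists g. destruct (UD y Y2) as [d [D1 [D2 D3]]]. specialize (G4 d D1 D2).
  repeat split; auto; order.
Qed.

Lemma square_drop C D : square_seq C -> club lt D -> square_seq (drop C D).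
Proof.
  intros HC HD a Ha. destruct (HC a Ha) as [[C1 [C2 C3]] [[f [F1 F2]] C4]].
  destruct (classic (unbounded_in lt D a)) as [UD|ND].
  - split; [split; [|split]|split].
    + intros x [[_ [g [G1 [_ [G2 _]]]]]|[_ [K _]]]; auto. specialize (C1 g G1). order.
    + now apply drop_unbounded.
    + intros b Hb Hbl U. destruct (drop_limit C1 UD U) as [UDb UCb].
      (* A limit of the drop lies in both [C a] and [D], so it is its own floor. *)
      left. split; auto. exists b. split; [auto|]. split; [now apply (club_of_limit HD)|].
      split; [now right|auto].
    (* The order type does not grow: increasing floors have increasing preimages in [C a]. *)
    + destruct (functional_choice (fun x g => drop C D a x -> C a g /\ floor_in D x g)) as [e He].
      { intros x. destruct (classic (drop C D a x)) as [[[_ [g Hg]]|[N _]]|N];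
          [eauto|tauto|exists x; tauto]. }
      exists (fun x => f (e x)). split.
      * intros x Hx. apply F1, He, Hx.
      * intros x y Hx Hy L. destruct (He x Hx) as [X1 [X2 [X3 X4]]], (He y Hy) as [Y1 [Y2 [Y3 Y4]]].
        apply F2; auto. specialize (X4 y Y2 L). exact (lt_le_tr Hwo _ X4 Y3).
    + intros b [B1 [B2 B3]] x. destruct (drop_limit C1 UD B3) as [UDb UCb].
      assert (Hbl : is_limit lt b) by (destruct B2; eapply limit_of_unbounded; eauto).
      assert (Hba : lt b a).
      { destruct B1 as [[_ [g [G1 [_ [G2 _]]]]]|[_ [K _]]]; auto. specialize (C1 g G1). order. }
      assert (HDb : D b) by now apply (club_of_limit HD).
      assert (Hb : forall x, C b x <-> C a x /\ lt x b) by (apply C4; split; auto).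
      split.
      * intros [[_ [g [G1 [G2 [G3 G4]]]]]|[N _]]; [|tauto]. apply Hb in G1. split; [|order].
        left. split; auto. exists g. split; [tauto|split; auto].
      * intros [[[_ [g [G1 [G2 [G3 G4]]]]]|[N _]] L]; [|tauto].
        left. split; auto. exists g. split; [apply Hb; auto|split; auto].
  - assert (Hsub : forall x, drop C D a x -> C a x) by (intros x [[K _]|[_ [K _]]]; tauto).
    split; [split; [|split]|split].
    + auto.
    + intros b Hb. assert (exists c, lt c a /\ forall d, D d -> lt c d -> le lt a d) as [c [K1 K2]].
      { apply NNPP; intros N. apply ND. intros c Hc. apply NNPP; intros M. apply N.
        exists c. split; auto. intros d Dd Lc. apply (nlt_le Hwo). intros K; apply M; eauto. }
      destruct (max2 Hwo b c) as [m [M1 [M2 M3]]].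
      assert (Hm : lt m a) by (destruct M3; subst; auto).
      destruct (C2 m Hm) as [x [X1 [X2 X3]]]. exists x. split; [right|split; order].
      repeat split; auto. intros d Dd L. apply K2; auto. order.
    + intros b Hb Hbl U. right. split; auto. split.
      * apply C3; auto. eapply unbounded_mono; [|exact U]. auto.
      * intros d Dd L. destruct Hbl as [[z Hz] _].
        destruct (U z Hz) as [y [[[K _]|[_ [_ K]]] [_ Ly]]]; [tauto|]. apply K; auto. order.
    + exists f. split; auto.
    + intros b [B1 [B2 B3]] x.
      assert (Hb : forall x, C b x <-> C a x /\ lt x b).
      { apply C4. split; [auto|split; auto]. eapply unbounded_mono; [|exact B3]. auto. }
      assert (Hba : lt b a) by auto.
      assert (Heq : forall x d, drop C D a x -> D d -> le lt x d -> le lt a d)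
        by (intros x' d [[K _]|[_ [_ K]]]; [tauto|apply K]).
      assert (NDb : ~ unbounded_in lt D b).
      { intros UDb. destruct B2 as [z Hz]. destruct (B3 z Hz) as [y [Y1 [Y2 Y3]]].
        destruct (UDb y Y3) as [d [D1 [D2 D3]]].
        assert (le lt a d) by (apply (Heq y); auto; now left). order. }
      split.
      * intros [[K _]|[_ [K1 K2]]]; [tauto|]. apply Hb in K1. split; [|tauto].
        right. repeat split; [auto|tauto|]. intros d Dd L. specialize (K2 d Dd L).
        apply (Heq b); auto.
      * intros [K L]. right. repeat split; [auto|apply Hb; auto|].
        intros d Dd Ld. specialize (Heq x d K Dd Ld). order.
Qed.

(** * Iterating drops to guess clubs *)

Lemma small_emb (A B : Type) : emb A B -> small lt lam B -> small lt lam A.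
Proof. intros H [g [G1 G2]]. exists g. split; auto. eapply emb_trans; eauto. Qed.

Lemma small_drop C D a : small lt lam {x | C a x} -> small lt lam {x | drop C D a x}.
Proof.
  apply small_emb.
  destruct (classic (unbounded_in lt D a)) as [UD|ND].
  - apply emb_choice with (R := fun x g => floor_in D (proj1_sig x) (proj1_sig g)).
    + intros [x Hx]. assert (K : exists g, C a g /\ floor_in D x g)
        by (destruct Hx as [[_ K]|[N _]]; tauto).
      destruct K as [g [G1 G2]]. now exists (exist _ g G1).
    + intros [x Hx] [y Hy] g H1 H2. apply subset_eq_compat. eapply floor_unique; eauto.
  - apply emb_sig. intros x [[K _]|[_ [K _]]]; tauto.
Qed.

Lemma club_inter_below (i : W) (D : W -> W -> Prop) : (forall j, lt j i -> club lt (D j)) ->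
  club lt (fun x => forall j, lt j i -> D j x).
Proof.
  intros H.
  destruct (@club_inter _ _ _ Hwo Hsucc Hunc (seg lt i) (fun s => D (proj1_sig s)))
    as [K1 K2].
  - now apply emb_seg_lam.
  - intros [j Hj]; auto.
  - split.
    + intros b. destruct (K1 b) as [c [L1 L2]]. exists c. split; auto.
      intros j Hj. exact (L1 (exist _ j Hj)).
    + intros b Hb U j Hj. apply (club_of_limit (H j Hj)); auto.
      eapply unbounded_mono; [|exact U]. auto.
Qed.

Theorem club_guessing_square C S : square_seq C -> guess_ready C S ->
  exists C', square_seq C' /\ guesses_clubs C' S.
Proof.
  intros HC HS. apply NNPP; intros Hno.
  (* [N D] is a club with an index function that together defeat [drop C D]; for [D] not a club it
     is a default pair. *)
  destruct (functional_choice (fun (D : W -> Prop) (N : (W -> Prop) * (W -> W -> W)) =>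
    club lt D -> club lt (fst N) /\
    (forall p g, fst N p -> fst N g -> lt p g -> lt (snd N p g) lam) /\
    forall a, S a -> is_limit lt a -> (forall x, drop C D a x -> fst N x) ->
      small lt lam {x | drop C D a x} -> forall j, lt j lam ->
      ~ limits_cofinal (fun g => exists p, adjacent (drop C D a) p g /\ lt (snd N p g) j) a))
    as [N HN].
  { intros D. destruct (classic (club lt D)) as [HD|HD]; [|exists (D, fun x _ => x); tauto].
    apply NNPP; intros Hn. apply Hno. exists (drop C D). split; [now apply square_drop|].
    intros D' h HD' Hh. apply NNPP; intros Hm. apply Hn. exists (D', h). intros _. simpl.
    repeat split; try apply HD'; auto. intros a Sa La Ha Hsm j Hj Hl. apply Hm. exists a; eauto 7. }
  destruct (@wf_rec_ex W lt _ (fun i rec => N (fun x => forall j (H : lt j i), fst (rec j H) x))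
    (ord_wf Hwo)) as [R HR].
  set (Dup := fun i x => forall j, lt j i -> fst (R j) x).
  assert (HR' : forall i, R i = N (Dup i)) by exact HR.
  assert (HcR : forall i, club lt (fst (R i))).
  { intros i. induction (ord_wf Hwo i) as [i _ IH]. rewrite HR'. apply HN.
    apply club_inter_below. auto. }
  assert (HcD : forall i, club lt (Dup i)) by (intros; apply club_inter_below; auto).
  assert (Hdec : forall i j x, le lt i j -> Dup j x -> Dup i x).
  { intros i j x L K k Hk. apply K. order. }
  (* Since [Dup] decreases, a point chosen for [Dup lam] serves all stages below [lam]
     simultaneously. *)
  destruct (HS (Dup lam) (HcD lam)) as [a [Sa [La [UE [Hsm Hgood]]]]].
  destruct (HC a La) as [[C1 [C2 C3]] _].
  assert (HUi : forall i b, le lt i lam -> unbounded_in lt (Dup lam) b -> unbounded_in lt (Dup i) b).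
  { intros i b Hi. apply unbounded_mono. intros; eapply Hdec; eauto. }
  (* For each stage, [e] returns some [g] in [C a] with its current floor, a floor outside the club
     that defeats the stage. *)
  destruct (functional_choice (fun (s : seg lt lam) (z : W * {x | C a x}) =>
     floor_in (Dup (proj1_sig s)) (fst z) (proj1_sig (snd z)) /\
     ~ fst (R (proj1_sig s)) (fst z))) as [e He].
  { intros [i Hi]; simpl. apply NNPP; intros Hne.
    assert (Li : le lt i lam) by now left.
    pose proof (HUi i a Li UE) as UDi.
    assert (Hsub : forall x, drop C (Dup i) a x -> fst (R i) x).
    { intros x [[_ [g [G1 G2]]]|[K _]]; [|tauto].
      apply NNPP; intros K. apply Hne. exists (x, exist _ g G1). auto. }
    destruct (HN (Dup i) (HcD i)) as [_ [Hh Hbad]]. rewrite <- HR' in Hh, Hbad.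
    (* The predecessor [p] of [g] is unique, so the two-place index function becomes a function of
       [g] alone. *)
    destruct (functional_choice (fun g v => forall p, adjacent (drop C (Dup i) a) p g ->
                 v = snd (R i) p g)) as [h Hhh].
    { intros g. destruct (classic (exists p, adjacent (drop C (Dup i) a) p g)) as [[p Hp]|Hp].
      - exists (snd (R i) p g). intros p' Hp'. f_equal. eapply adjacent_unique; eauto.
      - exists g. intros p Hp'. exfalso; eauto. }
    destruct (square_drop HC (HcD i) La) as [[K1 [K2 _]] _].
    destruct (Hgood (fun g => exists p, adjacent (drop C (Dup i) a) p g) h) as [j [Hj Hl]].
    - intros b [p [_ [Hb _]]]. now apply K1.
    - now apply adjacent_unbounded.
    - intros b Hb Hbl UC UEb. apply adjacent_unbounded, drop_unbounded; auto.
    - intros b [p Hp]. rewrite (Hhh b p Hp). destruct Hp as [P1 [P2 [P3 _]]]. auto.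
    - apply (Hbad a Sa La Hsub (small_drop _ _ _ Hsm) j Hj).
      eapply limits_cofinal_mono; [|exact Hl]. intros x [[p Hp] L]. exists p. split; auto.
      rewrite <- (Hhh x p Hp). auto. }
  apply (@not_emb_lam_small_prod _ _ _ Hwo Hsucc Hunc {x | C a x} nat); auto.
  { now apply small_nat. }
  apply (@emb_descending_fibres W lt (seg lt lam) _
    (fun s t => lt (proj1_sig s) (proj1_sig t)) (fun s => snd (e s)) (fun s => fst (e s)) Hwo).
  - apply seg_wf; auto.
  - apply seg_tot; auto.
  (* For a fixed [g], the floor at the later stage [t] lies in [Dup] of both stages and in the club
     found at [s], which the floor at [s] avoids. Hence the floor has strictly dropped. *)
  - intros s t L E. destruct (He s) as [[S1 [S2 S3]] S4], (He t) as [[T1 [T2 T3]] T4].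
    rewrite <- E in T2.
    destruct (tot (fst (e t)) (fst (e s))) as [K|[K|K]]; auto; exfalso.
    + apply S4. rewrite <- K. apply T1. auto.
    + assert (K' : Dup (proj1_sig s) (fst (e t))) by (eapply Hdec; [|exact T1]; now left).
      specialize (S3 _ K' K). exact (le_nlt Hwo T2 S3).
Qed.

End Squares.

(** * Coding approximations by ordinals *)

Section Diamonds.
Variables (W : Type) (lt : W -> W -> Prop) (lam : W).
Hypothesis Hwo : strict_wellorder lt.
Hypothesis Hsucc : is_succ_card_of lt lam.
Hypothesis Hunc : uncountable lt lam.

Let irr := ord_irr Hwo.
Let tr := ord_tr Hwo.
Let tot := ord_tot Hwo.
Ltac order := solve [order_with irr tr tot].

(* [X xi b] decodes [xi] as a subset of lam * lam * b. *)
Lemma coding_ex : CH lt lam ->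
  exists (K : (W -> W -> W -> Prop) -> W -> W) (X : W -> W -> W -> W -> W -> Prop),
    forall Z b j i x, lt j lam -> lt i lam -> lt x b ->
      (X (K Z b) b j i x <-> Z j i x).
Proof.
  intros [F HF].
  assert (He : forall b, emb (seg lt lam * (seg lt lam * seg lt b)) (seg lt lam)).
  { intros b. pose proof (emb_lam_lam Hwo Hunc) as H.
    eapply emb_trans; [|exact H]. apply emb_prod; [apply emb_refl|].
    eapply emb_trans; [|exact H]. apply emb_prod; [apply emb_refl|].
    now apply emb_seg_lam. }
  set (f := fun b => proj1_sig (constructive_indefinite_description _ (He b))).
  assert (Hf : forall b x y, f b x = f b y -> x = y).
  { intros b. exact (proj2_sig (constructive_indefinite_description _ (He b))). }
  set (code := fun (Z : W -> W -> W -> Prop) b v => exists z, v = proj1_sig (f b z) /\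
    Z (proj1_sig (fst z)) (proj1_sig (fst (snd z))) (proj1_sig (snd (snd z)))).
  set (K := fun Z b => F (code Z b)).
  assert (HK : forall Z Z' b j i x, K Z b = K Z' b -> lt j lam -> lt i lam -> lt x b ->
     Z j i x -> Z' j i x).
  { intros Z Z' b j i x E Hj Hi Hx HZ.
    assert (Hcode : forall Y v, code Y b v -> lt v lam)
      by (intros Y v [z [-> _]]; apply proj2_sig).
    pose proof (HF _ _ (Hcode Z) (Hcode Z') E) as H.
    set (z := (exist (fun y => lt y lam) j Hj,
               (exist (fun y => lt y lam) i Hi, exist (fun y => lt y b) x Hx))).
    assert (Hz : code Z b (proj1_sig (f b z))) by (exists z; auto).
    apply H in Hz. destruct Hz as [z' [E' HZ']].
    assert (E2 : z = z').
    { apply (Hf b). revert E'. destruct (f b z), (f b z'). simpl. apply subset_eq_compat. }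
    subst z'. exact HZ'. }
  (* Decoding picks any [Z'] whose code at [b] is [xi]; by [HK] all choices agree below [b]. *)
  exists K, (fun xi b => epsilon (inhabits (fun _ _ _ => True)) (fun Z => K Z b = xi)).
  intros Z b j i x Hj Hi Hx.
  pose proof (epsilon_spec (inhabits (fun _ _ _ : W => True)) (fun Z' => K Z' b = K Z b)
    (ex_intro _ Z eq_refl)) as E.
  split; apply (HK _ _ b); auto.
Qed.

(** * Thinning a square sequence *)

Section Thin.
Variables (C : W -> W -> Prop) (G : W -> W -> Prop) (Y : W -> W -> W -> Prop).

Definition good_pts (c : W -> Prop) (g : W) : Prop := exists p, adjacent lt c p g /\ G p g.

(* The closure of the good points when they are cofinal, a tail of [C a] otherwise. *)
Definition thin (a x : W) : Prop :=
  C a x /\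
  ((unbounded_in lt (good_pts (C a)) a /\
     (good_pts (C a) x \/ is_limit lt x /\ unbounded_in lt (good_pts (C a)) x)) \/
   (~ unbounded_in lt (good_pts (C a)) a /\ forall g, good_pts (C a) g -> lt g x)).

(* Reading [x] off the first good pair above it makes the guesses cohere, however wrong they are. *)
Definition thin_guess (a x : W) : Prop :=
  lt x a /\ unbounded_in lt (good_pts (C a)) a /\
  exists p g, adjacent lt (C a) p g /\ G p g /\ lt x p /\ Y p g x /\
    forall p' g', adjacent lt (C a) p' g' -> G p' g' -> lt x p' -> le lt g g'.

Lemma good_pts_restrict (c c' : W -> Prop) (d g : W) : (forall x, c' x <-> c x /\ lt x d) ->
  (good_pts c' g <-> good_pts c g /\ lt g d).
Proof.
  intros H. unfold good_pts. split.
  - intros [p [P1 P2]]. apply (adjacent_restrict Hwo _ _ _ _ _ H) in P1. destruct P1. eauto.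
  - intros [[p [P1 P2]] L]. exists p. split; auto. apply (adjacent_restrict Hwo _ _ _ _ _ H). auto.
Qed.

Lemma good_pts_unbounded_restrict (c c' : W -> Prop) (d x : W) :
  (forall x, c' x <-> c x /\ lt x d) -> le lt x d ->
  (unbounded_in lt (good_pts c') x <-> unbounded_in lt (good_pts c) x).
Proof.
  intros H L. split; apply unbounded_mono; intros y Hy Ly.
  - now apply (good_pts_restrict _ _ _ H) in Hy.
  - apply (good_pts_restrict _ _ _ H). split; auto. order.
Qed.

Lemma thin_sub a x : thin a x -> C a x.
Proof. now intros [H _]. Qed.

Lemma thin_acc a b : acc lt (thin a) b -> acc lt (C a) b.
Proof.
  intros [B1 [B2 B3]]. split; [now apply thin_sub|split; auto].
  eapply unbounded_mono; [|exact B3]. intros; now apply thin_sub.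
Qed.

Lemma thin_limit a b : unbounded_in lt (good_pts (C a)) a ->
  unbounded_in lt (thin a) b -> unbounded_in lt (good_pts (C a)) b.
Proof.
  intros U UT x Hx. destruct (UT x Hx) as [y [[_ [[_ [K|[_ K]]]|[N _]]] [L1 L2]]]; [eauto| |tauto].
  destruct (K x L1) as [z [? [? ?]]]. exists z; eauto.
Qed.

Lemma thin_square : square_seq lt lam C -> forall a, is_limit lt a ->
  club_in lt a (thin a) /\ otp_le lt (thin a) lam /\
  (forall b, acc lt (thin a) b ->
     (forall x, thin b x <-> (thin a x /\ lt x b)) /\
     (forall x, thin_guess b x <-> (thin_guess a x /\ lt x b))).
Proof.
  intros HC a Ha. destruct (HC a Ha) as [[C1 [C2 C3]] [[f [F1 F2]] C4]].
  split; [split; [|split]|split].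
  - intros x Hx. apply C1. now apply thin_sub.
  - destruct (classic (unbounded_in lt (good_pts (C a)) a)) as [U|N].
    + eapply unbounded_mono; [|exact U]. intros x Hx _. split; [|auto].
      now destruct Hx as [p [[_ [Hx _]] _]].
    + intros b Hb.
      assert (exists c, lt c a /\ forall g, good_pts (C a) g -> le lt g c) as [c [K1 K2]].
      { apply NNPP; intros M. apply N. intros c Hc. apply NNPP; intros M'. apply M.
        exists c. split; auto. intros g Hg. apply (nlt_le Hwo). intros L. apply M'.
        exists g. repeat split; auto. destruct Hg as [p [[_ [Hg _]] _]]. auto. }
      destruct (max2 Hwo b c) as [m [M1 [M2 M3]]].
      assert (Hm : lt m a) by (destruct M3; subst; auto).
      destruct (C2 m Hm) as [x [X1 [X2 X3]]]. exists x. split; [|split; order].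
      split; auto. right. split; auto. intros g Hg. specialize (K2 g Hg). order.
  - intros b Hb Hbl U.
    assert (Hb' : C a b).
    { apply C3; auto. eapply unbounded_mono; [|exact U]. intros; now apply thin_sub. }
    split; auto.
    destruct (classic (unbounded_in lt (good_pts (C a)) a)) as [UG|N]; [left|right].
    + split; auto. right. split; auto. now apply thin_limit.
    + split; auto. intros g Hg. destruct Hbl as [[z Hz] _].
      destruct (U z Hz) as [y [[_ [[K _]|[_ K]]] [L1 L2]]]; [tauto|]. eauto.
  - exists f. split; intros; [apply F1|apply F2]; auto; now apply thin_sub.
  - intros b Hb. pose proof (C4 b (thin_acc Hb)) as Hres. destruct Hb as [B1 [B2 B3]].
    assert (Hba : lt b a) by (apply C1; now apply thin_sub).
    (* The case distinction in [thin] comes out alike at [a] and at [b]; the rest of coherence is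
       restriction to [b]. *)
    assert (HU : unbounded_in lt (good_pts (C b)) b <-> unbounded_in lt (good_pts (C a)) a).
    { rewrite (good_pts_unbounded_restrict _ _ Hres) by now right. split.
      - intros Ub. apply NNPP; intros N. destruct B2 as [z Hz].
        destruct (B3 z Hz) as [y [[_ [[K _]|[_ K]]] [L1 L2]]]; [tauto|].
        destruct (Ub y L2) as [g [Hg [L3 L4]]]. specialize (K g Hg). order.
      - intros Ua. now apply thin_limit. }
    split; intros x; split.
    + intros [T1 T2]. apply Hres in T1. split; [|tauto]. split; [tauto|].
      rewrite HU in T2. destruct T2 as [[T2 T3]|[T2 T3]]; [left|right]; split; auto.
      * rewrite (good_pts_restrict _ _ _ Hres) in T3.
        rewrite (good_pts_unbounded_restrict _ _ Hres) in T3 by (left; tauto). tauto.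
      * intros g Hg. destruct (tot g b) as [L|L].
        -- apply T3. now apply (good_pts_restrict _ _ _ Hres).
        -- exfalso. destruct B1 as [_ [[K _]|[_ K]]]; [tauto|]. specialize (K g Hg). order.
    + intros [[T1 T2] L]. split; [now apply Hres|].
      rewrite HU. destruct T2 as [[T2 T3]|[T2 T3]]; [left|right]; split; auto.
      * rewrite (good_pts_restrict _ _ _ Hres).
        rewrite (good_pts_unbounded_restrict _ _ Hres) by now left. tauto.
      * intros g Hg. apply T3. now apply (good_pts_restrict _ _ _ Hres) in Hg.
    + intros [T1 [T2 [p [g [P1 [P2 [P3 [P4 P5]]]]]]]]. split; auto. split; [eauto|].
      apply HU in T2. split; auto.
      apply (adjacent_restrict Hwo _ _ _ _ _ Hres) in P1. destruct P1 as [P1 Lg].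
      exists p, g. repeat (split; auto).
      intros p' g' Q1 Q2 Q3. destruct (tot g' b) as [L|L]; [|order].
      apply (P5 p'); auto. apply (adjacent_restrict Hwo _ _ _ _ _ Hres). auto.
    + intros [[T1 [T2 [p [g [P1 [P2 [P3 [P4 P5]]]]]]]] L]. split; auto. apply HU in T2.
      split; auto. exists p, g.
      (* Of two good points between [x] and [b], the larger has its predecessor at or above the
         smaller, hence above [x]. So the first good pair above [x] already lies below [b]. *)
      assert (Lg : lt g b).
      { destruct (T2 x L) as [g1 [G1 [L1 L2]]]. destruct (T2 g1 L2) as [g2 [[p2 [G2 G3]] [L3 L4]]].
        apply (adjacent_restrict Hwo _ _ _ _ _ Hres) in G2. destruct G2 as [G2 _].
        assert (Lp : le lt g1 p2).
        { apply (good_pts_restrict _ _ _ Hres) in G1. destruct G1 as [[p1 [[_ [G1 _]] _]] _].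
          apply (nlt_le Hwo). intros K. destruct G2 as [_ [_ [_ G2]]]. specialize (G2 _ G1 K). order. }
        assert (le lt g g2) by (apply (P5 p2); auto; order). order. }
      split; [now apply (adjacent_restrict Hwo _ _ _ _ _ Hres)|]. repeat (split; auto).
      intros p' g' Q1 Q2 Q3. apply (P5 p'); auto. now apply (adjacent_restrict Hwo _ _ _ _ _ Hres) in Q1.
Qed.

Lemma thin_guess_correct (A : W -> Prop) a : unbounded_in lt (good_pts (C a)) a ->
  (forall p g x, adjacent lt (C a) p g -> G p g -> lt x p -> (Y p g x <-> A x)) ->
  forall x, thin_guess a x <-> (A x /\ lt x a).
Proof.
  intros U H x. split.
  - intros [T1 [_ [p [g [P1 [P2 [P3 [P4 _]]]]]]]]. split; auto. eapply H; eauto.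
  - intros [HA L]. split; auto. split; auto.
    destruct (@least _ _ Hwo (fun g => exists p, adjacent lt (C a) p g /\ G p g /\ lt x p))
      as [g [[p [P1 [P2 P3]]] P4]].
    { destruct (U x L) as [g1 [[p1 [[_ [G1 _]] _]] [L1 L2]]].
      destruct (U g1 L2) as [g2 [[p2 [G2 G3]] [L3 L4]]].
      exists g2, p2. repeat (split; auto). apply (lt_le_tr Hwo) with g1; auto.
      apply (nlt_le Hwo). intros K. destruct G2 as [_ [_ [_ G2]]]. specialize (G2 _ G1 K). order. }
    exists p, g. repeat (split; auto). { eapply H; eauto. }
    intros p' g' Q1 Q2 Q3. apply P4. eauto.
Qed.

End Thin.

(** * Guessing sets on thinned square sequences *)

Theorem diamond_of_guesses_clubs C S : CH lt lam -> square_seq lt lam C ->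
  guesses_clubs lt lam C S -> diamond_square lt lam S.
Proof.
  intros HCH HC HS. apply NNPP; intros Hno.
  destruct (coding_ex HCH) as [K [X HX]].
  destruct (index_ex Hsucc) as [q [Hq1 Hq2]].
  (* [N] returns a club and a set that the candidate thinned by [G] with proposals [Y] fails to
     guess. *)
  destruct (functional_choice (fun (GY : (W -> W -> Prop) * (W -> W -> W -> Prop))
     (N : (W -> Prop) * (W -> Prop)) =>
     club lt (fst N) /\ forall a, S a -> is_limit lt a ->
       (forall x, thin C (fst GY) a x -> fst N x) ->
       (forall x, thin_guess C (fst GY) (snd GY) a x <-> (snd N x /\ lt x a)) ->
       ~ sup_is lt (acc lt (thin C (fst GY) a)) a)) as [N HN].
  { intros [G Y]. apply NNPP; intros Hn. apply Hno.
    exists (thin C G), (thin_guess C G Y). split; [|split].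
    - now intros a x [H _].
    - now apply thin_square.
    - intros D A HD. apply NNPP; intros Hm. apply Hn. exists (D, A). split; auto.
      intros a Sa La H1 H2 H3. apply Hm. exists a. auto. }
  (* The code [xi] has index below [j] in the enumeration of [g], and its decoding agrees below [p]
     with all sets found before stage [i]. A pair is good when it has such a code, and it then
     proposes the union of their sections at [i]. *)
  set (V := fun j i (A : forall i', lt i' i -> W -> Prop) p g xi =>
    lt xi g /\ lt (q g xi) j /\
    forall i' (H : lt i' i) x, lt x p -> (X xi p j i' x <-> A i' H x)).
  set (GY := fun j i A => (fun p g => exists xi, V j i A p g xi,
                           fun p g x => exists xi, V j i A p g xi /\ X xi p j i x)).
  (* The bound [j] is known only after a club has been guessed, so the iteration is run for every
     [j] at once and the codes cover all runs. *)
  destruct (functional_choice (fun j (R : W -> (W -> Prop) * (W -> Prop)) =>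
     forall i, R i = N (GY j i (fun i' _ => snd (R i'))))) as [R HR].
  { intros j. exact (wf_rec_ex (fun i rec => N (GY j i (fun i' H => snd (rec i' H)))) (ord_wf Hwo)). }
  set (A := fun j i => snd (R j i)).
  set (E0 := fun x => forall j, lt j lam -> forall i, lt i lam -> fst (R j i) x).
  (* Between points [p] and [g] of this club the code of the approximation up to [p] lies below [g],
     so it has an index there. *)
  destruct (closure_club Hwo Hsucc Hunc (fun p => K A p)) as [E1a E1b].
  set (E1 := fun d => is_limit lt d /\ forall x, lt x d -> lt (K A x) d).
  assert (HE : club lt (fun x => E0 x /\ E1 x)).
  { apply (club_inter2 Hwo Hsucc Hunc); [|split; auto].
    apply (club_inter_below Hwo Hsucc Hunc). intros j _.
    apply (club_inter_below Hwo Hsucc Hunc). intros i _. rewrite HR. apply HN. }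
  destruct (HS (fun x => E0 x /\ E1 x) (fun p g => q g (K A p)) HE) as
    [a [Sa [La [HaE [Hsm [j [Hj Hlim]]]]]]].
  { intros p g _ [_ Hg] L. apply Hq1. now apply Hg. }
  destruct (HC a La) as [[C1 [C2 C3]] _].
  (* The true code is never discarded, so the pairs where its index is below [j] stay good at every
     stage. *)
  assert (HVcode : forall i, lt i lam -> forall p g, adjacent lt (C a) p g ->
     lt (q g (K A p)) j -> V j i (fun i' _ => A j i') p g (K A p)).
  { intros i Hi p g [P1 [P2 [P3 _]]] L. repeat split; auto.
    - destruct (HaE g P2) as [_ Hg]. now apply Hg.
    - apply HX; eauto.
    - intros H'. apply HX; eauto. }
  (* otherwise stage [i] would have guessed [A j i] at [a] *)
  assert (Hbad : forall i, lt i lam -> exists p g xi, adjacent lt (C a) p g /\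
     V j i (fun i' _ => A j i') p g xi /\ exists x, lt x p /\ ~ (X xi p j i x <-> A j i x)).
  { intros i Hi. apply NNPP; intros Hn.
    destruct (HN (GY j i (fun i' _ => A j i'))) as [_ Hfail].
    change (fun i' (_ : lt i' i) => A j i') with (fun i' (_ : lt i' i) => snd (R j i')) in Hfail.
    rewrite <- HR in Hfail.
    set (G := fst (GY j i (fun i' _ => snd (R j i')))) in Hfail.
    set (Y := snd (GY j i (fun i' _ => snd (R j i')))) in Hfail.
    assert (Hsub : forall g, (exists p, adjacent lt (C a) p g /\ lt (q g (K A p)) j) ->
       good_pts G (C a) g).
    { intros g [p [P1 P2]]. exists p. split; auto. exists (K A p). now apply HVcode. }
    assert (UG : unbounded_in lt (fun b => is_limit lt b /\ unbounded_in lt (good_pts G (C a)) b) a).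
    { exact (limits_cofinal_mono _ Hsub Hlim). }
    assert (UG' : unbounded_in lt (good_pts G (C a)) a).
    { apply (unbounded_trans Hwo). eapply unbounded_mono; [|exact UG]. intros x [_ Hx] _. exact Hx. }
    apply (Hfail a Sa La).
    - intros x Hx. apply thin_sub in Hx. destruct (HaE x Hx) as [H0 _]. now apply H0.
    - apply thin_guess_correct; auto. intros p g x P1 [xi0 V0] L. split.
      + intros [xi [Hxi HXx]]. apply NNPP; intros M. apply Hn. exists p, g, xi.
        repeat (split; auto). exists x. split; auto. unfold A. tauto.
      + intros HA. exists xi0. split; auto. apply NNPP; intros M. apply Hn. exists p, g, xi0.
        repeat (split; auto). exists x. split; auto. unfold A. tauto.
    - split.
      + intros x [Hx _]. left. apply C1. now apply thin_sub in Hx.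
      + intros b Hb. destruct (UG b Hb) as [c [[Lc Uc] [K1 K2]]]. exists c. split; auto.
        assert (Ut : unbounded_in lt (thin C G a) c).
        { eapply unbounded_mono; [|exact Uc]. intros x Hx _. split; [|auto].
          now destruct Hx as [p [[_ [Hx _]] _]]. }
        split; [|split; [now exists b|auto]].
        split; [|auto]. apply C3; auto.
        eapply unbounded_mono; [|exact Ut]. intros x Hx _. now apply thin_sub in Hx. }
  apply (@not_emb_lam_small_prod _ _ _ Hwo Hsucc Hunc {x | C a x} (seg lt j)); auto.
  { exists j. split; auto. apply emb_refl. }
  (* Stage [i] is sent to a point [g] and the index of a code that was consistent before [i] and
     disagrees with [A j i]. At a later stage that code is no longer consistent, so no pair
     recurs. *)
  apply emb_choice with (R := fun (s : seg lt lam) (z : {x | C a x} * seg lt j) =>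
    exists p xi, adjacent lt (C a) p (proj1_sig (fst z)) /\
      V j (proj1_sig s) (fun i' _ => A j i') p (proj1_sig (fst z)) xi /\
      proj1_sig (snd z) = q (proj1_sig (fst z)) xi /\
      exists x, lt x p /\ ~ (X xi p j (proj1_sig s) x <-> A j (proj1_sig s) x)).
  - intros [i Hi]. destruct (Hbad i Hi) as [p [g [xi [P1 [P2 [x [Hx P3]]]]]]].
    assert (Hg : C a g) by apply P1. assert (Hxi : lt (q g xi) j) by apply P2.
    exists (exist _ g Hg, exist _ (q g xi) Hxi), p, xi. simpl. repeat (split; auto). eauto.
  - intros s t [[g Hg] [v Hv]]; simpl.
    intros [p [xi [P1 [V1 [E1' [x [Lx Nx]]]]]]] [p' [xi' [P1' [V1' [E1'' [x' [Lx' Nx']]]]]]].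
    assert (p = p') by (eapply adjacent_unique; eauto). subst p'.
    assert (xi = xi') by (apply (Hq2 g); [apply V1|apply V1'|congruence]). subst xi'.
    destruct (seg_tot Hwo _ s t) as [L|[L|L]]; auto; exfalso.
    + apply Nx. destruct V1' as [_ [_ H]]. now apply H.
    + apply Nx'. destruct V1 as [_ [_ H]]. now apply H.
Qed.

End Diamonds.

(** * Stationary and reflecting target sets *)

Section Targets.
Variables (W : Type) (lt : W -> W -> Prop) (lam : W).
Hypothesis Hwo : strict_wellorder lt.
Hypothesis Hsucc : is_succ_card_of lt lam.
Hypothesis Hunc : uncountable lt lam.

Let irr := ord_irr Hwo.
Let tr := ord_tr Hwo.
Let tot := ord_tot Hwo.
Ltac order := solve [order_with irr tr tot].

(** If [lam] were [b + 1], it would embed into the infinite [b]. *)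
Lemma lam_limit : is_limit lt lam.
Proof.
  destruct (small_nat Hwo Hunc) as [g [Hg Hng]]. split; [eauto|].
  intros b Hb. apply NNPP; intros N.
  assert (Hgb : le lt g b).
  { apply (nlt_le Hwo). intros L. apply N. eauto. }
  destruct Hsucc as [H _]. apply (H b Hb). apply emb_injects.
  eapply emb_trans; [|apply emb_option_inf, (emb_trans Hng), (emb_seg_le Hwo Hgb)].
  eapply emb_trans; [|apply emb_le_option].
  apply emb_sig. intros x Hx. apply (nlt_le Hwo). intros L. apply N. eauto.
Qed.

Lemma not_unbounded (A : W -> Prop) a : ~ unbounded_in lt A a -> (forall x, A x -> lt x a) ->
  exists c, lt c a /\ forall x, A x -> le lt x c.
Proof.
  intros N H. apply NNPP; intros M. apply N. intros c Hc. apply NNPP; intros M'. apply M.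
  exists c. split; auto. intros x Hx. apply (nlt_le Hwo). intros L. apply M'. exists x; auto.
Qed.

(** Otherwise the points with [h] below [j] are bounded by some [g j] below [a]. Composing [g] with
    a cofinal map into [lam] gives cf(a) at most cf(lam), and [h] along a cofinal sequence from [B]
    gives the reverse. *)
Lemma cf_neq_bounded a (B : W -> Prop) (h : W -> W) : cf_neq lt a lam ->
  (forall b, B b -> lt b a) -> unbounded_in lt B a -> (forall b, B b -> lt (h b) lam) ->
  exists j, lt j lam /\ unbounded_in lt (fun b => B b /\ lt (h b) j) a.
Proof.
  intros [k1 [k2 [Hk1 [Hk2 Hne]]]] HB UB Hh. apply NNPP; intros N.
  destruct (functional_choice (fun j c => lt j lam ->
    lt c a /\ forall b, B b /\ lt (h b) j -> le lt b c)) as [g Hg].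
  { intros j. destruct (classic (lt j lam)) as [Hj|Hj]; [|exists j; tauto].
    destruct (@not_unbounded (fun b => B b /\ lt (h b) j) a) as [c Hc].
    - intros U. apply N. eauto.
    - intros x [Hx _]; auto.
    - exists c; auto. }
  assert (L1 : le lt k1 k2).
  { destruct Hk2 as [[f [F1 [_ F3]]] _].
    apply (@cf_le_of_unbounded _ _ Hwo a k2 k1 (fun x => g (f x))); auto.
    - intros x Hx. apply Hg. auto.
    - intros b Hb. destruct (UB b Hb) as [b' [B1 [B2 B3]]].
      destruct lam_limit as [_ Hlim]. destruct (Hlim (h b') (Hh b' B1)) as [j [J1 J2]].
      destruct (F3 j J2) as [x [X1 X2]]. exists x. split; auto.
      destruct (Hg (f x) (F1 x X1)) as [_ K].
      left. apply (lt_le_tr Hwo) with b'; auto. apply K. split; auto.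
      eapply lt_le_tr; eauto. }
  assert (L2 : le lt k2 k1).
  { destruct Hk1 as [[f [F1 [_ F3]]] _].
    destruct (functional_choice (fun x b => lt x k1 -> B b /\ lt (f x) b)) as [e He].
    { intros x. destruct (classic (lt x k1)) as [Hx|Hx]; [|exists x; tauto].
      destruct (UB (f x) (F1 x Hx)) as [b [? [? ?]]]. eauto. }
    apply (@cf_le_of_unbounded _ _ Hwo lam k1 k2 (fun x => h (e x))); auto.
    - intros x Hx. apply Hh, He, Hx.
    - intros j Hj. destruct (Hg j Hj) as [K1 K2]. destruct (F3 _ K1) as [x [X1 X2]].
      exists x. split; auto. apply (nlt_le Hwo). intros L. destruct (He x X1) as [E1 E2].
      apply (le_nlt Hwo (K2 (e x) (conj E1 L))). eapply le_lt_tr; eauto. }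
  apply Hne. order.
Qed.

Lemma small_of_increasing (c : W -> Prop) (f : W -> W) j : lt j lam ->
  (forall x, c x -> lt (f x) j) -> (forall x y, c x -> c y -> lt x y -> lt (f x) (f y)) ->
  small lt lam {x | c x}.
Proof.
  intros Hj H1 H2. exists j. split; auto.
  exists (fun x => exist (fun y => lt y j) (f (proj1_sig x)) (H1 _ (proj2_sig x))).
  intros [x Hx] [y Hy] E. injection E; simpl; intros E'. apply subset_eq_compat.
  destruct (tot x y) as [L|[L|L]]; auto; exfalso; apply H2 in L; auto; rewrite E' in L;
    exact (irr L).
Qed.

(** The order type map stays below some [j] at cofinally many points of [c], hence everywhere, being
    increasing. *)
Lemma small_of_cf_neq a (c : W -> Prop) : cf_neq lt a lam -> club_in lt a c ->
  otp_le lt c lam -> small lt lam {x | c x}.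
Proof.
  intros Hcf [C1 [C2 _]] [f [F1 F2]].
  destruct (@cf_neq_bounded a c f Hcf C1 C2 F1) as [j [Hj U]].
  apply (small_of_increasing _ f Hj); auto.
  intros x Hx. destruct (U x (C1 x Hx)) as [y [[Y1 Y2] [Y3 _]]]. eauto.
Qed.

Lemma limits_cofinal_of_cf a (B : W -> Prop) : cf_gt_omega lt a ->
  unbounded_in lt B a -> limits_cofinal lt B a.
Proof.
  intros Ha U. destruct (common_limits_club Hwo Ha U U) as [_ [K _]].
  eapply unbounded_mono; [|exact K]. intros x; cbv beta; tauto.
Qed.

Lemma guess_ready_of_cf C T : square_seq lt lam C -> stationary lt T ->
  (forall a, T a -> cf_gt_omega lt a /\ cf_neq lt a lam) -> guess_ready lt lam C T.
Proof.
  intros HC HT Hcf E HE.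
  destruct (HT _ (club_limits Hwo Hsucc Hunc HE)) as [a [Ta [La UE]]].
  destruct (Hcf a Ta) as [K1 K2]. destruct (HC a La) as [HCa [Hotp _]].
  exists a. repeat (split; auto). { eapply small_of_cf_neq; eauto. }
  intros B h HB UB _ Hh. destruct (@cf_neq_bounded a B h K2 HB UB Hh) as [j [Hj U]].
  exists j. split; auto. now apply limits_cofinal_of_cf.
Qed.

(** At a guessing point [a] of [R], [S] meets the club of limits of [acc (C a)]. Such a point [b] is
    in [acc (C a)], so coherence restricts the guess at [a] to [b]. *)
Lemma diamond_square_reflect R S :
  (forall a, R a -> cf_gt_omega lt a /\ stationary_in lt a S) ->
  diamond_square lt lam R -> diamond_square lt lam S.
Proof.
  intros HR [C [Sg [H1 [H2 H3]]]]. exists C, Sg. split; [auto|split; [auto|]].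
  intros D A HD. destruct (H3 D A HD) as [a [Ra [La [HCD [HA [_ Hacc]]]]]].
  destruct (HR a Ra) as [Hcf Hst]. destruct (H2 a La) as [[C1 [C2 C3]] [_ Hcoh]].
  assert (U : unbounded_in lt (acc lt (C a)) a).
  { intros b Hb. destruct (Hacc b Hb) as [x [X1 X2]]. exists x. split; [exact X1|split; auto].
    apply C1, X1. }
  destruct (Hst _ (common_limits_club Hwo Hcf U U)) as [b [Hb [Sb [_ [Lb [Ub _]]]]]].
  assert (UC : unbounded_in lt (C a) b).
  { eapply unbounded_mono; [|exact Ub]. now intros x [Hx _]. }
  assert (Hab : acc lt (C a) b).
  { split; [now apply C3|]. split; [apply Lb|auto]. }
  destruct (Hcoh b Hab) as [K1 K2].
  exists b. split; auto. split; auto. split; [|split; [|split]].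
  - intros x Hx. apply K1 in Hx. now apply HCD.
  - intros x. rewrite K2, HA. split; [tauto|]. intros [? ?]; repeat split; eauto.
  - intros x [Hx _]. left. now apply K1 in Hx.
  - intros c Hc. destruct (Ub c Hc) as [x [[X1 [X2 X3]] [X4 X5]]]. exists x. split; auto.
    split; [now apply K1|]. split; auto.
    intros y Hy. destruct (X3 y Hy) as [z [Z1 [Z2 Z3]]]. exists z. repeat split; auto.
    apply K1. eauto.
Qed.

(* If cf(a) = cf(lam), club many b < a have cofinality below cf(lam), so that every function from
   a cofinal subset of such a b to lam is bounded on it. *)
Lemma guess_ready_of_reflection C S : square_seq lt lam C ->
  stationary lt (fun a => (cf_gt_omega lt a /\ stationary_in lt a S) /\ ~ cf_neq lt a lam) ->
  guess_ready lt lam C S.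
Proof.
  intros HC HR E HE.
  destruct (HR _ (club_limits Hwo Hsucc Hunc HE)) as [a [[[Hcf Hst] Hneq] [La UE]]].
  destruct (HC a La) as [[C1 [C2 C3]] [[f [F1 F2]] Hcoh]].
  destruct (is_cf_ex Hwo a) as [k Hk], (is_cf_ex Hwo lam) as [k2 Hk2].
  assert (k = k2) by (apply NNPP; intros N; apply Hneq; exists k, k2; auto). subst k2.
  destruct Hk as [[g [G1 [G2 G3]]] _].
  assert (UG : unbounded_in lt (fun y => exists x, lt x k /\ y = g x) a).
  { intros b Hb. destruct La as [_ La]. destruct (La b Hb) as [c [L1 L2]].
    destruct (G3 c L2) as [x [X1 X2]]. exists (g x). split; [eauto|].
    split; auto. eapply lt_le_tr; eauto. }
  (* Limits are taken twice to combine three sets: points of [K2] are limits of [C a], of [E] and of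
     the range of [g]. The chosen [b] in [S] is a limit of [K2]. *)
  pose proof (common_limits_club Hwo Hcf C2 UE) as [_ [U1 _]].
  pose proof (common_limits_club Hwo Hcf U1 UG) as [_ [U2 _]].
  match type of U2 with unbounded_in _ ?K _ => set (K2 := K) in U2 end.
  assert (HK2 : forall b, K2 b -> is_limit lt b /\ unbounded_in lt (C a) b /\
     unbounded_in lt E b /\ unbounded_in lt (fun y => exists x, lt x k /\ y = g x) b).
  { intros b [_ [Lb [Ub Ub']]]. repeat (split; [now auto|]). split; [|split; auto];
      apply (unbounded_trans Hwo); (eapply unbounded_mono; [|exact Ub]);
      intros x [_ [_ [? ?]]] _; auto. }
  destruct (Hst _ (common_limits_club Hwo Hcf U2 U2)) as [b [Hb [Sb [_ [Lb [Ub _]]]]]].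
  assert (UCb : unbounded_in lt (C a) b).
  { apply (unbounded_trans Hwo). eapply unbounded_mono; [|exact Ub]. intros x Hx _. now apply HK2. }
  assert (UEb : unbounded_in lt E b).
  { apply (unbounded_trans Hwo). eapply unbounded_mono; [|exact Ub]. intros x Hx _. now apply HK2. }
  assert (UGb : unbounded_in lt (fun y => exists x, lt x k /\ y = g x) b).
  { apply (unbounded_trans Hwo). eapply unbounded_mono; [|exact Ub]. intros x Hx _. now apply HK2. }
  assert (HCb : C a b) by (apply C3; auto).
  assert (Hres : forall x, C b x <-> C a x /\ lt x b).
  { apply Hcoh. split; auto. split; auto. apply Lb. }
  exists b. repeat (split; [now auto|]). split.
  (* As [b] is in [C a], the value [f b] bounds [f] on [C b]. *)
  { apply (small_of_increasing _ f (F1 b HCb)).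
    - intros x Hx. apply Hres in Hx. apply F2; tauto.
    - intros x y Hx Hy. apply Hres in Hx, Hy. apply F2; tauto. }
  intros B h HB UB HBlim Hh.
  (* The indices below [j0] are those that [g] sends below [b]; their number is less than
     cf(lam). *)
  destruct (@least _ _ Hwo (fun x => lt x k /\ le lt b (g x))) as [j0 [[J1 J2] J3]].
  { destruct (G3 b Hb) as [x Hx]. eauto. }
  assert (Hj0 : forall x, lt x k -> lt (g x) b -> lt x j0).
  { intros x Hx Lx. destruct (tot x j0) as [L|[L|L]]; auto; exfalso.
    - subst. exact (le_nlt Hwo J2 Lx).
    - specialize (G2 j0 x J1 Hx L). apply (le_nlt Hwo J2). eauto. }
  assert (Hj0' : forall x, lt x j0 -> lt (g x) b).
  { intros x Hx. apply NNPP; intros N. apply (nlt_le Hwo) in N.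
    apply (fun H => le_nlt Hwo (J3 x H) Hx). split; [eauto|auto]. }
  (* Taking the least point of [B] above [g x] keeps [e x] below every [c] in [K2] that exceeds
     [g x], so these points are cofinal in each such limit as well. *)
  destruct (functional_choice (fun x y => lt x j0 -> (B y /\ lt (g x) y) /\
     forall z, B z /\ lt (g x) z -> le lt y z)) as [e He].
  { intros x. destruct (classic (lt x j0)) as [Hx|Hx]; [|exists x; tauto].
    destruct (@least _ _ Hwo (fun y => B y /\ lt (g x) y)) as [y Hy]; [|exists y; auto].
    destruct (UB (g x)) as [y [? [? ?]]]; eauto. }
  (* An unbounded [h (e x)] for [x] below [j0] would give [lam] cofinality at most [j0], below
     [k]. *)
  assert (exists j, lt j lam /\ forall x, lt x j0 -> lt (h (e x)) j) as [j [Hj Hbd]].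
  { apply NNPP; intros N.
    apply (fun H => le_nlt Hwo H J1).
    apply (@cf_le_of_unbounded _ _ Hwo lam j0 k (fun x => h (e x))); auto.
    - intros x Hx. apply Hh. now apply He.
    - intros j Hj. apply NNPP; intros M. apply N. exists j. split; auto. intros x Hx.
      apply NNPP; intros M'. apply (nlt_le Hwo) in M'. apply M; eauto. }
  exists j. split; auto.
  eapply unbounded_mono; [|exact Ub]. intros c Hc Lc.
  destruct (HK2 c Hc) as [Llc [UCc [UEc UGc]]]. split; auto.
  assert (UBc : unbounded_in lt B c).
  { apply HBlim; auto. eapply unbounded_mono; [|exact UCc]. intros x Hx Lx. apply Hres. eauto. }
  intros d Hd. destruct (UGc d Hd) as [y [[x [Hx ->]] [Y1 Y2]]].
  assert (Hxj : lt x j0) by eauto.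
  destruct (He x Hxj) as [[E1 E2] E3]. exists (e x). split; [auto|]. split; [eauto|].
  destruct (UBc (g x) Y2) as [z [Z1 [Z2 Z3]]]. apply (le_lt_tr Hwo) with z; auto.
Qed.

Lemma stationary_split (A B : W -> Prop) :
  stationary lt A -> stationary lt (fun a => A a /\ B a) \/ stationary lt (fun a => A a /\ ~ B a).
Proof.
  intros HA. apply NNPP; intros N. apply not_or_and in N. destruct N as [N1 N2].
  apply not_all_ex_not in N1. destruct N1 as [D1 N1]. apply imply_to_and in N1.
  apply not_all_ex_not in N2. destruct N2 as [D2 N2]. apply imply_to_and in N2.
  destruct N1 as [K1 N1], N2 as [K2 N2].
  destruct (HA _ (club_inter2 Hwo Hsucc Hunc K1 K2)) as [a [Aa [? ?]]].
  destruct (classic (B a)); [apply N1|apply N2]; eauto.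
Qed.

End Targets.

(** * Deriving both clauses from [guess_ready] *)

Theorem theorem2p3 (W : Type) (lt : W -> W -> Prop) (lam : W)
  (Hwo : strict_wellorder lt) (Hsucc : is_succ_card_of lt lam)
  (Hunc : uncountable lt lam)
  (Hsq : square lt lam) (Hch : CH lt lam) :
  (forall T : W -> Prop, stationary lt T ->
     (forall a, T a -> cf_gt_omega lt a /\ cf_neq lt a lam) ->
     diamond_square lt lam T) /\
  (forall S : W -> Prop, reflects_stat_often lt S -> diamond_square lt lam S).
Proof.
  destruct Hsq as [C HC].
  assert (Main : forall S, guess_ready lt lam C S -> diamond_square lt lam S).
  { intros S HS. destruct (club_guessing_square Hwo Hsucc Hunc HC HS) as [C' [HC' HG]].
    exact (diamond_of_guesses_clubs Hwo Hsucc Hunc Hch HC' HG). }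
  assert (H1 : forall T : W -> Prop, stationary lt T ->
     (forall a, T a -> cf_gt_omega lt a /\ cf_neq lt a lam) -> diamond_square lt lam T).
  { intros T HT Hcf. apply Main. now apply guess_ready_of_cf. }
  split; [exact H1|].
  intros S HS.
  destruct (stationary_split Hwo Hsucc Hunc (fun a => cf_neq lt a lam) HS) as [HR|HR].
  - apply (@diamond_square_reflect _ _ lam Hwo
      (fun a => (cf_gt_omega lt a /\ stationary_in lt a S) /\ cf_neq lt a lam)); [tauto|].
    apply H1; [exact HR|]. intros a [[? _] ?]; auto.
  - apply Main. now apply guess_ready_of_reflection.
Qed.
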